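(* Let $x_1=w_1\varepsilon^{\mu_1}$ and $x_2=w_2\varepsilon^{\mu_2}$ be elements of $\widetilde W$. Then $x_1\le x_2$ in the Bruhat order if and only if for every $v_1\in W$ there exists $v_2\in W$ such that $$v_1^{-1}\mu_1+\mathrm{wt}(v_2\Rightarrow v_1)+\mathrm{wt}(w_1v_1\Rightarrow w_2v_2)\le v_2^{-1}\mu_2 .$$
   Context: Let $\Phi$ be a reduced crystallographic finite root system with fixed basis $\Delta$, positive roots $\Phi^+$, negative roots $\Phi^-=-\Phi^+$, Weyl group $W$ and $2\rho=\sum_{\beta\in\Phi^+}\beta$. For $\alpha\in\Phi$, $\alpha^\vee$ is its coroot and $s_\alpha$ its reflection; $\ell$ on $W$ is the Coxeter length with respect to $\{s_\alpha:\alpha\in\Delta\}$. Let $X_*$ be an abelian group containing the coroot lattice $\mathbb Z\Phi^\vee$, with a bilinear pairing $\langle\cdot,\cdot\rangle:X_*\times\mathbb Z\Phi\to\mathbb Z$ extending the natural coroot–root pairing; $W$ acts on $X_*$ by $s_\alpha(\mu)=\mu-\langle\mu,\alpha\rangle\alpha^\vee$. For $\mu,\mu'\in X_*$ write $\mu\le\mu'$ if $\mu'-\mu$ is a $\mathbb Z_{\ge0}$-linear combination of positive coroots. Write $\Phi^+(\alpha)=1$ if $\alpha\in\Phi^+$ and $\Phi^+(\alpha)=0$ if $\alpha\in\Phi^-$. The extended affine Weyl group is $\widetilde W=W\ltimes X_*$; its elements are written $w\varepsilon^\mu$ ($w\in W,\mu\in X_*$) with $\varepsilon^\mu w=w\varepsilon^{w^{-1}\mu}$.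 Affine roots are $\Phi_{\mathrm{af}}=\Phi\times\mathbb Z$, with $\widetilde W$-action $(w\varepsilon^\mu)(\alpha,k)=(w\alpha,k-\langle\mu,\alpha\rangle)$; positive affine roots are $\Phi_{\mathrm{af}}^+=\{(\alpha,k):k\ge\Phi^+(-\alpha)\}$ and $\Phi_{\mathrm{af}}^-=\Phi_{\mathrm{af}}\setminus\Phi_{\mathrm{af}}^+$. The length is $\ell(x)=\#\{a\in\Phi^+_{\mathrm{af}}:xa\in\Phi^-_{\mathrm{af}}\}$. For $a=(\alpha,k)$ the affine reflection is $r_a=s_\alpha\varepsilon^{k\alpha^\vee}$. The Bruhat order on $\widetilde W$ is the partial order generated by $x<xr_a$ for $x\in\widetilde W$, $a\in\Phi_{\mathrm{af}}$ with $\ell(x)<\ell(xr_a)$. The quantum Bruhat graph $\mathrm{QB}(W)$ is the directed graph with vertex set $W$ and an edge $w\to ws_\alpha$ ($\alpha\in\Phi^+$) whenever either $\ell(ws_\alpha)=\ell(w)+1$ (Bruhat edge, weight $0$) or $\ell(ws_\alpha)=\ell(w)+1-\langle\alpha^\vee,2\rho\rangle$ (quantum edge, weight $\alpha^\vee$). The weight of a path is the sum of its edge weights. It is known that $\mathrm{QB}(W)$ is strongly connected and that all shortest paths from $w$ to $w'$ have the same weight, denoted $\mathrm{wt}(w\Rightarrow w')\in\mathbb Z\Phi^\vee$; $d(w\Rightarrow w')$ denotes the length of a shortest path. *)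

(* Defs.v *)
From mathcomp Require Import all_boot all_order all_algebra.
From mathcomp Require Import boolp.
Set Implicit Arguments.
Unset Strict Implicit.
Unset Printing Implicit Defensive.
Import Order.TTheory GRing.Theory Num.Theory.
Local Open Scope ring_scope.

(* Standard pairing of V = Q^n with V^* = Q^n. *)
Definition dotv (n : nat) (u v : 'rV[rat]_n) : rat := \sum_(i < n) u 0 i * v 0 i.

Section RootSystem.
(* Roots are indexed (injectively) by 'I_N; root a in V = Q^n, coroot a in V^* = Q^n. *)
Variables (n N : nat) (root coroot : 'I_N -> 'rV[rat]_n).

Definition reflV (a : 'I_N) (v : 'rV[rat]_n) : 'rV[rat]_n :=
  v - dotv v (coroot a) *: root a.

Definition root_system : Prop :=
  [/\ injective root,
      forall a, root a != 0,
      forall v : 'rV[rat]_n, exists c : 'I_N -> rat, v = \sum_a c a *: root a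
    & forall a, dotv (root a) (coroot a) = 2] /\
  [/\ forall a b, exists c, root c = reflV a (root b),
      forall a b, dotv (root b) (coroot a) \is a Num.int
    & forall a b (c : rat), root b = c *: root a -> c = 1 \/ c = -1].

Variable simple : {set 'I_N}.

Definition root_basis : Prop :=
  (forall c : 'I_N -> rat, \sum_(s in simple) c s *: root s = 0 ->
     forall s, s \in simple -> c s = 0) /\
  (forall a, exists c : 'I_N -> nat,
     root a = \sum_(s in simple) (c s)%:R *: root s \/
     root a = - \sum_(s in simple) (c s)%:R *: root s).

Definition posr (a : 'I_N) : bool :=
  `[< exists c : 'I_N -> nat, root a = \sum_(s in simple) (c s)%:R *: root s >].

(* Elements of W are represented by their (faithful) action on the roots. *)
Definition Wt := {ffun 'I_N -> 'I_N}.
Definition sref (a : 'I_N) : Wt :=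
  [ffun j => odflt j [pick k | root k == reflV a (root j)]].
Definition W1 : Wt := [ffun j => j].
Definition Wmul (u v : Wt) : Wt := [ffun j => u (v j)].
Definition Winv (w : Wt) : Wt := [ffun j => odflt j [pick k | w k == j]].
Definition prodW (s : seq 'I_N) : Wt := foldr (fun a w => Wmul (sref a) w) W1 s.
Definition simple_word (s : seq 'I_N) : bool := all (fun a => a \in simple) s.
Definition inW (w : Wt) : Prop := exists s, simple_word s /\ prodW s = w.
Definition has_word (w : Wt) (m : nat) : bool :=
  [exists t : m.-tuple 'I_N, simple_word t && (prodW t == w)].
(* Coxeter length: least length of a word in simple reflections
   (any reduced word has length < #|W| <= N^N). *)
Definition coxlen (w : Wt) : nat := find (has_word w) (iota 0 (N ^ N).+1)%N.
Definition redword (w : Wt) : seq 'I_N :=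
  if [pick t : (coxlen w).-tuple 'I_N | simple_word t && (prodW t == w)] is Some t
  then val t else [::].

Variables (X : zmodType) (pairR : X -> 'I_N -> int) (corX : 'I_N -> X).

(* X_* : abelian group with an embedding of the coroot lattice
   (corX a = image of a^vee) and a bilinear pairing X_* x ZPhi -> Z
   (given by its values on roots, compatible with all Z-relations among roots)
   extending the natural coroot-root pairing. *)
Definition cochar_data : Prop :=
  [/\ forall (x y : X) a, pairR (x + y) a = pairR x a + pairR y a,
      forall (x : X) (c : 'I_N -> int),
        \sum_a (c a)%:~R *: root a = 0 -> \sum_a c a * pairR x a = 0,
      forall c : 'I_N -> int,
        \sum_a corX a *~ c a = 0 <-> \sum_a (c a)%:~R *: coroot a = 0
    & forall a b, (pairR (corX b) a)%:~R = dotv (root a) (coroot b)].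

Definition reflX (a : 'I_N) (mu : X) : X := mu - corX a *~ pairR mu a.
Definition actW (w : Wt) (mu : X) : X := foldr reflX mu (redword w).

Definition leX (mu nu : X) : Prop :=
  exists c : 'I_N -> nat, nu - mu = \sum_(a | posr a) corX a *+ c a.

Definition rho2 (a : 'I_N) : rat := \sum_(b | posr b) dotv (root b) (coroot a).
Definition bruhat_edge (w : Wt) (a : 'I_N) : bool :=
  posr a && (coxlen (Wmul w (sref a)) == (coxlen w).+1)%N.
Definition quantum_edge (w : Wt) (a : 'I_N) : bool :=
  posr a && ((coxlen (Wmul w (sref a)))%:R == (coxlen w)%:R + 1 - rho2 a :> rat).
Definition qb_edge (w : Wt) (a : 'I_N) : bool := bruhat_edge w a || quantum_edge w a.
Fixpoint qb_path (u v : Wt) (p : seq 'I_N) : bool :=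
  if p is a :: p' then qb_edge u a && qb_path (Wmul u (sref a)) v p' else u == v.
Fixpoint qb_wt (u : Wt) (p : seq 'I_N) : X :=
  if p is a :: p' then (if quantum_edge u a then corX a else 0) + qb_wt (Wmul u (sref a)) p'
  else 0.
Definition qdist (u v : Wt) : nat :=
  find (fun d => [exists t : d.-tuple 'I_N, qb_path u v t]) (iota 0 (N ^ N).+1)%N.
Definition qwt (u v : Wt) : X :=
  if [pick t : (qdist u v).-tuple 'I_N | qb_path u v t] is Some t then qb_wt u t else 0.

(* Extended affine Weyl group: (w, mu) stands for w eps^mu. *)
Definition Waf := (Wt * X)%type.
Definition affmul (x y : Waf) : Waf := (Wmul x.1 y.1, actW (Winv y.1) x.2 + y.2).
Definition affrefl (a : 'I_N) (k : int) : Waf := (sref a, corX a *~ k).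
Definition thr (a : 'I_N) : int := if posr a then 0 else 1.
(* l(x) = #{(a,k) positive : x(a,k) negative}, where x(a,k) = (w a, k - <mu,a>);
   for fixed a all such k lie in [0, |<mu,a>|]. *)
Definition afflen (x : Waf) : nat :=
  (\sum_(a : 'I_N)
     count (fun k : int => (thr a <= k)%R && (k - pairR x.2 a < thr (x.1 a))%R)
           [seq (i%:Z) | i <- iota 0 (`|pairR x.2 a| + 2)])%N.
Inductive bruhat_le : Waf -> Waf -> Prop :=
| bruhat_refl x : bruhat_le x x
| bruhat_step x y a k : bruhat_le x y ->
    (afflen y < afflen (affmul y (affrefl a k)))%N ->
    bruhat_le x (affmul y (affrefl a k)).

End RootSystem.

(* Main.v *)
(** Order [W x X] by the semi-infinite order [sle], generated by the reflections
    [y < y r] for which the semi-infinite length [lsi] (the Coxeter length plus the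
    pairing with 2 rho) increases.  Its covers are the edges of the quantum Bruhat
    graph, and [(u, nu) <= (u', nu')] holds exactly when [wt (u => u') <= nu' - nu].
    Hence the criterion says that for every z there is [z' <= z] with
    [x1 z <= x2 z'].

    If [x1 < x1 r] is a Bruhat step, then for each z either [x1 z < x1 r z] or
    [r z < z]; this gives one direction by transitivity.

    For the converse, left multiplication by a simple affine reflection s satisfies
    the lifting property for both orders.  One inducts on the length of x2, with
    [s x2 < x2]: lifting replaces x2 by [s x2], and x1 by [s x1] when [s x1 < x1],
    provided that z = v1 is length positive for x1, and also for [s x1] when
    [s x1 > x1].  So one must be able to pass from one length positive element to
    another.  They form a connected gallery, and crossing a wall between two of them
    rests on [sigma_sle], a substitute for lifting on the right.

    Both [sigma_sle] and the existence of minimal weights are proved by multiplying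
    on the left along a reduced word of a dominant translation conjugated by u: as
    long as the finite parts of [y <= y'] differ essentially, some letter raises y
    and lowers y', which shortens the interval. *)

Require Import Defs.
From mathcomp Require Import all_boot all_order all_algebra.
From mathcomp Require Import boolp.
From mathcomp Require Import zify ring lra.
Import Order.TTheory GRing.Theory Num.Theory.
Local Open Scope ring_scope.
Set Implicit Arguments.
Unset Strict Implicit.
Unset Printing Implicit Defensive.

Section AffineBruhat.

Variables (n N : nat) (root coroot : 'I_N -> 'rV[rat]_n) (simple : {set 'I_N}).
Hypotheses (HPhi : root_system root coroot) (HDelta : root_basis root simple).
Variables (X : zmodType) (pairR : X -> 'I_N -> int) (corX : 'I_N -> X).
Hypothesis HX : cochar_data root coroot pairR corX.

Local Notation I := 'I_N.
Local Notation W := (Wt N).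
Local Notation Wa := (Waf N X).
Local Notation s_ := (sref root coroot).
Local Notation pos := (posr root simple).
Local Notation thr := (thr root simple).
Local Notation prodW := (prodW root coroot).
Local Notation word := (simple_word simple).
Local Notation inW := (inW root coroot simple).
Local Notation coxlen := (coxlen root coroot simple).
Local Notation leX := (leX root simple corX).
Local Notation actW := (actW root coroot simple pairR corX).
Local Notation reflX := (reflX pairR corX).
Local Notation "x ** y" := (affmul root coroot simple pairR corX x y)
  (at level 40, left associativity).
Local Notation afflen := (afflen root simple pairR).
Local Notation bruhat := (bruhat_le root coroot simple pairR corX).
Local Notation qwt := (qwt root coroot simple corX).

(** * Roots and coroots *)

Lemma pairRD (x y : X) a : pairR (x + y) a = pairR x a + pairR y a.
Proof. by case: HX. Qed.

Lemma pairR0 a : pairR 0 a = 0.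
Proof. by have := pairRD 0 0 a; rewrite addr0; lia. Qed.

Lemma pairRN x a : pairR (- x) a = - pairR x a.
Proof. by have := pairRD x (- x) a; rewrite subrr pairR0; lia. Qed.

Lemma pairRB x y a : pairR (x - y) a = pairR x a - pairR y a.
Proof. by rewrite pairRD pairRN. Qed.

Lemma pairRMn x k a : pairR (x *+ k) a = pairR x a *+ k.
Proof. by elim: k => [|k IH]; rewrite ?pairR0 // !mulrS pairRD IH. Qed.

Lemma pairRMz x (k : int) a : pairR (x *~ k) a = k * pairR x a.
Proof.
have P (m : nat) : pairR (x *~ m%:Z) a = m%:Z * pairR x a.
  by rewrite -pmulrn pairRMn -mulr_natl natz.
by case: k => k; rewrite ?NegzE ?mulrNz ?pairRN P ?mulNr.
Qed.

Lemma pairR_sum (T : Type) (r : seq T) (P : pred T) (F : T -> X) a :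
  pairR (\sum_(i <- r | P i) F i) a = \sum_(i <- r | P i) pairR (F i) a.
Proof.
by apply: (big_morph (fun x => pairR x a)) => [x y|]; rewrite ?pairRD ?pairR0.
Qed.

(* [cr a b] is the Cartan integer <root a, coroot b>. *)
Definition cr (a b : I) : int := pairR (corX b) a.

Lemma crE a b : (cr a b)%:~R = dotv (root a) (coroot b).
Proof. by case: HX => _ _ _; apply. Qed.

Lemma root_inj : injective root.
Proof. by case: HPhi => -[]. Qed.

Lemma cr_diag a : cr a a = 2.
Proof.
have : (cr a a)%:~R = 2 :> rat by rewrite crE; case: HPhi => -[].
by move/eqP; rewrite -[2]/(2%:~R) eqr_int => /eqP.
Qed.

Lemma root_sref a b : root (s_ a b) = root b - (cr b a)%:~R *: root a.
Proof.
rewrite ffunE; case: pickP => [k /eqP->|H]; first by rewrite /reflV crE.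
case: HPhi => _ [/(_ a b)[c Hc] _ _].
by have := H c; rewrite Hc eqxx.
Qed.

Lemma pair_rel x (c : I -> int) :
  \sum_a (c a)%:~R *: root a = 0 -> \sum_a c a * pairR x a = 0.
Proof. by case: HX => _ H _ _; exact: H. Qed.

(** [pairR] is given on roots only; linearity comes from [pair_rel], applied to a coefficient
    function supported on the three roots. *)
Lemma pair_comb2 x a b c (i j : int) :
  root c = i%:~R *: root a + j%:~R *: root b ->
  pairR x c = i * pairR x a + j * pairR x b.
Proof.
move=> E.
have delta (V : lmodType rat) (f : I -> V) p (k : int) :
    \sum_d (k * (d == p)%:R)%:~R *: f d = k%:~R *: f p.
  rewrite (bigD1 p) //= eqxx mulr1 big1 ?addr0 // => d /negPf->.
  by rewrite mulr0 scale0r.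
have deltaZ (f : I -> int) p (k : int) : \sum_d (k * (d == p)%:R) * f d = k * f p.
  rewrite (bigD1 p) //= eqxx mulr1 big1 ?addr0 // => d /negPf->.
  by rewrite mulr0 mul0r.
have := @pair_rel x (fun d => 1 * (d == c)%:R - i * (d == a)%:R - j * (d == b)%:R).
under eq_bigr do rewrite !rmorphB /= !scalerBl.
rewrite !sumrB !delta scale1r E -addrA -opprD subrr => /(_ erefl).
under eq_bigr do rewrite !mulrBl.
by rewrite !sumrB !deltaZ; lia.
Qed.

Lemma pair_sref x a b : pairR x (s_ a b) = pairR x b - cr b a * pairR x a.
Proof.
have /pair_comb2 -> : root (s_ a b) = 1%:~R *: root b + (- cr b a)%:~R *: root a.
  by rewrite scale1r mulrNz scaleNr root_sref.
by rewrite mul1r mulNr.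
Qed.

Lemma cr_srefl a b c : cr (s_ a b) c = cr b c - cr b a * cr a c.
Proof. exact: pair_sref. Qed.

Lemma sref_invol a b : s_ a (s_ a b) = b.
Proof.
apply: root_inj; rewrite !root_sref cr_srefl cr_diag.
have -> : cr b a - cr b a * 2 = - cr b a by ring.
by rewrite mulrNz scaleNr opprK subrK.
Qed.

Lemma sref_inj a : injective (s_ a).
Proof. exact: can_inj (sref_invol a). Qed.

Definition neg (a : I) : I := s_ a a.

Lemma root_neg a : root (neg a) = - root a.
Proof.
by rewrite root_sref cr_diag -[X in X - _]scale1r -scalerBl -[RHS]scaleN1r.
Qed.

Lemma negK a : neg (neg a) = a.
Proof. by apply: root_inj; rewrite !root_neg opprK. Qed.

Lemma pair_neg x a : pairR x (neg a) = - pairR x a.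
Proof. by rewrite pair_sref cr_diag; ring. Qed.

(* Functions on the roots that are restrictions of linear forms. *)
Definition lin (f : I -> rat) := forall a e, f (s_ a e) = f e - (cr e a)%:~R * f a.
Definition dotf (f g : I -> rat) : rat := \sum_e f e * g e.
Definition crr (b : I) : I -> rat := fun a => (cr a b)%:~R.

Lemma lin_crr b : lin (crr b).
Proof. by move=> a e; rewrite /crr cr_srefl rmorphB rmorphM. Qed.

Lemma lin_coord i : lin (fun a => root a 0 i).
Proof. by move=> a e; rewrite root_sref !mxE. Qed.

Lemma dotf_sref f g a : dotf (f \o s_ a) (g \o s_ a) = dotf f g.
Proof.
by rewrite /dotf [RHS](reindex_inj (@sref_inj a)).
Qed.

Lemma dotf_sym f g : dotf f g = dotf g f.
Proof. by apply: eq_bigr => e _; rewrite mulrC. Qed.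

Lemma dotf_lincomb f g h (k l : rat) :
  dotf (fun e => k * f e - l * g e) h = k * dotf f h - l * dotf g h.
Proof.
rewrite /dotf !mulr_sumr -sumrB; apply: eq_bigr => e _.
by rewrite mulrBl !mulrA.
Qed.

(** [dotf] is invariant under [s_ a], which negates [crr a] and turns [f] into [f - f a * crr a]. *)
Lemma dotf_crr a f : lin f -> 2 * dotf (crr a) f = f a * dotf (crr a) (crr a).
Proof.
move=> lf; have := dotf_sref (crr a) f a.
have -> : dotf (crr a \o s_ a) (f \o s_ a) =
          dotf (fun e => f a * crr a e - 1 * f e) (crr a).
  apply: eq_bigr => e _ /=; rewrite lf /crr cr_srefl cr_diag rmorphB rmorphM /=.
  rewrite -[2%:~R]/(2 : rat); ring.
rewrite dotf_lincomb (dotf_sym f) => E.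
have {}E : dotf (crr a) f = f a * dotf (crr a) (crr a) - dotf (crr a) f.
  by rewrite -{1}E mul1r.
by rewrite mulr_natl mulr2n {2}E addrC subrK.
Qed.

Lemma dotf_eq0 f : dotf f f = 0 -> forall e, f e = 0.
Proof.
move=> H e; apply/eqP; rewrite -sqrf_eq0 expr2.
have := H; rewrite /dotf => /eqP.
rewrite psumr_eq0 => [/allP/(_ e)|i _]; last by rewrite -expr2 sqr_ge0.
by rewrite mem_index_enum => /(_ isT).
Qed.

Lemma dotf_ge0 f : 0 <= dotf f f.
Proof. by apply: sumr_ge0 => e _; rewrite -expr2 sqr_ge0. Qed.

Lemma dotf_crr_gt0 a : 0 < dotf (crr a) (crr a).
Proof.
rewrite lt0r dotf_ge0 andbT; apply/eqP => /dotf_eq0/(_ a).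
by rewrite /crr cr_diag.
Qed.

(* A coroot is determined by its root: up to scaling it is the Riesz
   representative of the root for the invariant form [dotf]. *)
Lemma cr_sref e c a : cr e (s_ c a) = cr (s_ c e) a.
Proof.
pose b := s_ c a; pose g := crr a \o s_ c.
have lin_sc f : lin f -> lin (f \o s_ c).
  move=> lf d x /=; rewrite !lf cr_srefl rmorphB rmorphM /=; ring.
have dg f : lin f -> 2 * dotf g f = f b * dotf (crr a) (crr a).
  move=> lf; rewrite -(dotf_crr a (lin_sc _ lf)) -(dotf_sref (crr a) _ c).
  congr (2 * _); apply: eq_bigr => x _ /=.
  by rewrite sref_invol.
pose ka := dotf (crr a) (crr a); pose kb := dotf (crr b) (crr b).
(* By [dotf_crr] and [dg], [h] is orthogonal to every linear form, in particular to itself, so it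
   vanishes; at [b] both [crr b] and [g] equal 2, which gives [ka = kb]. *)
pose h x := ka * crr b x - kb * g x.
have lh : lin h.
  have lg : lin g := lin_sc _ (lin_crr a).
  by move=> d x; rewrite /h (lin_crr b) lg; ring.
have h0 : dotf h h = 0.
  apply: (@mulfI _ 2) => //; rewrite mulr0 dotf_lincomb mulrBr !(mulrCA 2).
  by rewrite (dotf_crr b lh) dg // -/ka -/kb; ring.
have gb : g b = 2 by rewrite /g /b /= sref_invol /crr cr_diag.
have kab : ka = kb.
  have := dotf_eq0 h0 b; rewrite /h gb /crr cr_diag => /eqP.
  by rewrite subr_eq0 => /eqP/(mulIf _); apply.
have := dotf_eq0 h0 e; rewrite /h kab -mulrBr => /eqP.
rewrite mulf_eq0 /kb gt_eqF ?dotf_crr_gt0 //= subr_eq0 => /eqP.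
by rewrite /g /crr /= => /eqP; rewrite eqr_int => /eqP.
Qed.

Lemma cr_srefr e c a : cr e (s_ c a) = cr e a - cr e c * cr c a.
Proof. by rewrite cr_sref cr_srefl. Qed.

Lemma sref_sref c a b : s_ c (s_ a b) = s_ (s_ c a) (s_ c b).
Proof.
apply: root_inj; rewrite !root_sref cr_sref sref_invol cr_srefl.
set x := cr b a; set y := cr b c; set z := cr a c.
rewrite !rmorphB !rmorphM /= !scalerBl !scalerBr !scalerA; apply/rowP => i; rewrite !mxE.
ring.
Qed.

Lemma sref_neg a b : s_ (neg a) b = s_ a b.
Proof.
apply: root_inj; rewrite [LHS]root_sref [RHS]root_sref root_neg /neg cr_sref cr_srefl cr_diag.
have -> : cr b a - cr b a * 2 = - cr b a by ring.
by rewrite mulrNz scaleNr scalerN opprK.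
Qed.

Lemma cr_negl a b : cr (neg a) b = - cr a b.
Proof. exact: pair_neg. Qed.

Lemma cr_negr a b : cr a (neg b) = - cr a b.
Proof. by rewrite cr_srefr cr_diag; ring. Qed.

Lemma sref_negr a b : s_ a (neg b) = neg (s_ a b).
Proof. by rewrite sref_sref. Qed.

Lemma cr_crr a b : (cr a b)%:~R * dotf (crr a) (crr a) =
                   (cr b a)%:~R * dotf (crr b) (crr b).
Proof.
by rewrite -[LHS](dotf_crr a (lin_crr b)) -[RHS](dotf_crr b (lin_crr a)) dotf_sym.
Qed.

Lemma cr_gt0_sym a b : 0 < cr a b -> 0 < cr b a.
Proof.
rewrite -(ltr0z rat) => H; have := cr_crr a b => E.
have : 0 < (cr b a)%:~R * dotf (crr b) (crr b) by rewrite -E mulr_gt0 ?dotf_crr_gt0.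
by rewrite pmulr_lgt0 ?dotf_crr_gt0 // ltr0z.
Qed.

(** The equality case of Cauchy-Schwarz: a product of at least 4 makes the two roots proportional,
    and reducedness leaves only [b = a] or [b = neg a]. *)
Lemma cr_bound a b : b != a -> b != neg a -> 0 < cr a b -> cr a b * cr b a <= 3.
Proof.
move=> nba nbna gt0; rewrite leNgt; apply/negP => H4.
pose ka := dotf (crr a) (crr a); pose kb := dotf (crr b) (crr b).
pose m := dotf (crr a) (crr b).
have ka0 : 0 < ka := dotf_crr_gt0 a; have kb0 : 0 < kb := dotf_crr_gt0 b.
have Ea : 2 * m = (cr a b)%:~R * ka by rewrite -(dotf_crr a (lin_crr b)).
have Eb : 2 * m = (cr b a)%:~R * kb by rewrite -(dotf_crr b (lin_crr a)) dotf_sym.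
have P4 : 4 <= (cr a b)%:~R * (cr b a)%:~R :> rat.
  by rewrite -rmorphM -[4]/(4%:~R) ler_int; lia.
pose h x := ka * crr b x - m * crr a x.
have hh : dotf h h = ka * (ka * kb - m * m).
  rewrite dotf_lincomb !(dotf_sym _ h) !dotf_lincomb -/ka -/kb -/m (dotf_sym (crr b)) -/m; ring.
have h0 : dotf h h = 0.
  apply/eqP; rewrite eq_le dotf_ge0 andbT hh pmulr_rle0 //.
  have : 4 * (m * m) = ((cr a b)%:~R * (cr b a)%:~R) * (ka * kb).
    have -> : 4 * (m * m) = (2 * m) * (2 * m) by ring.
    by rewrite {1}Ea Eb; ring.
  have : 0 < ka * kb by rewrite mulr_gt0.
  nra.
have prop f : lin f -> f b * kb * ka = m * ka * f a.
  move=> lf; rewrite -[f b * kb](dotf_crr b lf).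
  have : dotf h f = 0.
    rewrite /dotf big1 // => e _; rewrite (dotf_eq0 h0) mul0r //.
  rewrite dotf_lincomb => /eqP; rewrite subr_eq0 => /eqP E.
  rewrite mulrAC -mulrA E mulrCA (dotf_crr a lf) -/ka; ring.
have rb : root b = (m / kb) *: root a.
  apply/rowP => i; rewrite !mxE; have := prop _ (lin_coord i).
  move=> /(congr1 (fun x => x / ka / kb)) E.
  have kan : ka != 0 by rewrite gt_eqF.
  have kbn : kb != 0 by rewrite gt_eqF.
  by move: E; rewrite mulfK // mulfK // => ->; field; rewrite kan kbn.
case: HPhi => _ [_ _ /(_ _ _ _ rb)] [] E; move: rb; rewrite E.
  by rewrite scale1r => /root_inj e; rewrite e eqxx in nba.
by rewrite scaleN1r -root_neg => /root_inj e; rewrite e eqxx in nbna.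
Qed.

(** * The coroot lattice inside the cocharacter group *)

Definition inQ (x : X) := exists c : I -> int, x = \sum_a corX a *~ c a.

Lemma inQD x y : inQ x -> inQ y -> inQ (x + y).
Proof.
move=> [c ->] [d ->]; exists (fun a => c a + d a).
by rewrite -big_split; apply: eq_bigr => a _; rewrite mulrzDr.
Qed.

Lemma inQN x : inQ x -> inQ (- x).
Proof.
move=> [c ->]; exists (fun a => - c a).
by rewrite -sumrN; apply: eq_bigr => a _; rewrite mulrNz.
Qed.

Lemma inQ_cor a k : inQ (corX a *~ k).
Proof.
exists (fun b => k * (b == a)%:R).
rewrite (bigD1 a) //= eqxx mulr1 big1 ?addr0 // => b /negPf->.
by rewrite mulr0 mulr0z.
Qed.

Lemma inQ0 : inQ 0.
Proof. by exists (fun=> 0); rewrite big1 // => a _; rewrite mulr0z. Qed.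

(** The roots span the space, so a combination of coroots killed by all of them is zero. Elements of
    [X] outside the lattice may pair to zero with every root, so pairings decide an equality only
    when the difference is known to satisfy [inQ]. *)
Lemma inQ_eq0 x : inQ x -> (forall e, pairR x e = 0) -> x = 0.
Proof.
move=> [c ->] H; case: HX => _ _ /(_ c) [_ E] _; apply: E.
set f := \sum_a _.
have dot_root e : dotv (root e) f = 0.
  have -> : dotv (root e) f = \sum_a (c a)%:~R * dotv (root e) (coroot a).
    rewrite /f /dotv; under eq_bigr do rewrite summxE mulr_sumr.
    rewrite exchange_big /=; apply: eq_bigr => a _.
    by rewrite mulr_sumr; apply: eq_bigr => i _; rewrite mxE; ring.
  under eq_bigr do rewrite -crE -rmorphM.
  rewrite -rmorph_sum /=.
  suff -> : \sum_a c a * cr e a = 0 by [].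
  apply: etrans (H e); rewrite pairR_sum.
  by apply: eq_bigr => a _; rewrite pairRMz.
have dot0 v : dotv v f = 0.
  have [_ _ /(_ v)[d ->] _] : [/\ injective root, forall a, root a != 0,
      forall v : 'rV[rat]_n, exists c : I -> rat, v = \sum_a c a *: root a
    & forall a, dotv (root a) (coroot a) = 2] by case: HPhi.
  rewrite /dotv; under eq_bigr do rewrite summxE mulr_suml.
  rewrite exchange_big big1 // => a _ /=.
  under eq_bigr do rewrite mxE -mulrA.
  by rewrite -mulr_sumr -/(dotv _ _) dot_root mulr0.
apply/rowP => i; have := dot0 (delta_mx 0 i).
rewrite /dotv (bigD1 i) //= big1 => [|j /negPf nj]; rewrite !mxE ?eqxx ?mul1r ?addr0 //.
by rewrite nj mul0r.
Qed.

Lemma inQ_ext x y : inQ (x - y) -> (forall e, pairR x e = pairR y e) -> x = y.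
Proof.
move=> Q E; apply/eqP; rewrite -subr_eq0; apply/eqP; apply: inQ_eq0 => // e.
by rewrite pairRB E subrr.
Qed.

Lemma corX_sref a b : corX (s_ a b) = corX b - corX a *~ cr a b.
Proof.
apply: inQ_ext => [|e]; last first.
  by rewrite pairRB pairRMz -!/(cr _ _) cr_srefr mulrC.
rewrite -[corX (s_ a b)]mulr1z -[X in _ - (X - _)]mulr1z.
apply: inQD; first exact: inQ_cor.
by apply: inQN; apply: inQD; [|apply: inQN]; exact: inQ_cor.
Qed.

Lemma corX_neg a : corX (neg a) = - corX a.
Proof. by rewrite corX_sref cr_diag -{1}[corX a]mulr1z -mulrzBr -mulrN1z. Qed.

(** * Simple roots, heights and the dominance order *)

Lemma simple_indep (c : I -> rat) : \sum_(s in simple) c s *: root s = 0 ->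
  forall s, s \in simple -> c s = 0.
Proof. by case: HDelta => H _; exact: H. Qed.

Lemma cf_ex a : exists c : I -> int, root a = \sum_(s in simple) (c s)%:~R *: root s /\
  ((forall s, 0 <= c s) \/ (forall s, c s <= 0)).
Proof.
case: HDelta => _ /(_ a) [c [E|E]].
  by exists (fun s => (c s)%:Z); split=> //; left.
exists (fun s => - (c s)%:Z); split; last by right => s; lia.
by rewrite E -sumrN; apply: eq_bigr => s _; rewrite mulrNz scaleNr.
Qed.

Definition cf : I -> I -> int := projT1 (choice cf_ex).

Lemma cfE a : root a = \sum_(s in simple) (cf a s)%:~R *: root s.
Proof. by have [] := projT2 (choice cf_ex) a. Qed.

Lemma cf_sign a : (forall s, 0 <= cf a s) \/ (forall s, cf a s <= 0).
Proof. by have [] := projT2 (choice cf_ex) a. Qed.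

Lemma cf_uniq a (c : I -> rat) : root a = \sum_(s in simple) c s *: root s ->
  forall s, s \in simple -> (cf a s)%:~R = c s.
Proof.
move=> E s Hs; apply/eqP; rewrite -subr_eq0; apply/eqP; move: s Hs.
apply: (@simple_indep (fun s => (cf a s)%:~R - c s)).
by under eq_bigr do rewrite scalerBl; rewrite sumrB -cfE -E subrr.
Qed.

Lemma cf_sref a b s : s \in simple -> cf (s_ a b) s = cf b s - cr b a * cf a s.
Proof.
move=> Hs; apply/eqP; rewrite -(eqr_int rat).
rewrite (@cf_uniq _ (fun s => (cf b s - cr b a * cf a s)%:~R)) // root_sref.
rewrite {1}(cfE b) {1}(cfE a) scaler_sumr -sumrB; apply: eq_bigr => t _.
by rewrite rmorphB rmorphM /= scalerBl scalerA.
Qed.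

Lemma cf_simple s t : s \in simple -> t \in simple -> cf s t = (s == t)%:R.
Proof.
move=> Hs Ht; apply/eqP; rewrite -(eqr_int rat).
rewrite (@cf_uniq _ (fun t => (s == t)%:R)) //; first by case: (s == t).
rewrite (bigD1 s) //= eqxx scale1r big1 ?addr0 // => u /andP[_ /negPf].
by rewrite eq_sym => ->; rewrite scale0r.
Qed.

Definition ht a := \sum_(s in simple) cf a s.

Lemma ht_sref a b : ht (s_ a b) = ht b - cr b a * ht a.
Proof.
rewrite /ht mulr_sumr -sumrB; apply: eq_bigr => s; exact: cf_sref.
Qed.

Lemma ht_neg a : ht (neg a) = - ht a.
Proof. by rewrite ht_sref cr_diag; ring. Qed.

Lemma root_neq0 a : root a != 0.
Proof. by case: HPhi => -[]. Qed.

Lemma pos_cf a : pos a -> forall s, s \in simple -> 0 <= cf a s.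
Proof.
move=> /asboolP[c E] s Hs; rewrite -(ler_int rat) (cf_uniq E) //.
Qed.

Lemma ht_neq0 a : ht a != 0.
Proof.
apply/eqP => E; have := root_neq0 a; rewrite cfE big1 ?eqxx // => s Hs.
suff -> : cf a s = 0 by rewrite scale0r.
move/eqP: E; case: (cf_sign a) => H; [|rewrite -oppr_eq0 -sumrN];
  rewrite psumr_eq0 => [/allP/(_ s)|t _]; rewrite ?oppr_ge0 // mem_index_enum Hs;
  by rewrite /= ?oppr_eq0 => /(_ isT)/eqP.
Qed.

Lemma pos_ht a : pos a = (0 < ht a).
Proof.
apply/idP/idP => [Ha|Ha].
  by rewrite lt0r ht_neq0 sumr_ge0 // => s; exact: pos_cf.
case: (cf_sign a) => [H|H].
  apply/asboolP; exists (fun s => `|cf a s|%N); rewrite {1}cfE.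
  apply: eq_bigr => s _; congr (_ *: _).
  by rewrite -[cf a s in LHS]gez0_abs // pmulrn.
have : ht a <= 0 by apply: sumr_le0.
by rewrite leNgt Ha.
Qed.

(** Positivity of a root in terms of the sign of an integer: in this form [lia] settles the
    comparisons of thresholds. *)
Lemma thr_ht a : (thr a = 0 /\ 0 < ht a) \/ (thr a = 1 /\ ht a < 0).
Proof.
rewrite /thr; have := ht_neq0 a; have := pos_ht a.
by case: ifP => _; lia.
Qed.

Lemma thr_pos a : pos a -> thr a = 0.
Proof. by rewrite /thr => ->. Qed.

Lemma posN_neg a : pos (neg a) = ~~ pos a.
Proof. by rewrite !pos_ht ht_neg; have := ht_neq0 a; lia. Qed.

Lemma thr_neg a : thr (neg a) = 1 - thr a.
Proof. by have := thr_ht a; have := thr_ht (neg a); rewrite ht_neg; lia. Qed.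

Lemma neg_neq a : neg a != a.
Proof. by apply/eqP => E; have := posN_neg a; rewrite E; case: (pos a). Qed.

Lemma simple_ht s : s \in simple -> ht s = 1.
Proof.
move=> Hs; rewrite /ht (bigD1 s) //= cf_simple // eqxx big1 ?addr0 //.
by move=> t /andP[Ht /negPf ns]; rewrite cf_simple // eq_sym ns.
Qed.

Lemma simple_pos s : s \in simple -> pos s.
Proof. by move=> Hs; rewrite pos_ht simple_ht. Qed.

Lemma pos_cfP a s : s \in simple -> 0 < cf a s -> pos a.
Proof.
move=> Hs H; case: (cf_sign a) => [H1|/(_ s)]; last by lia.
rewrite pos_ht /ht (bigD1 s) //=.
by apply: ltr_pwDl => //; apply: sumr_ge0.
Qed.

Lemma pos_cf_other s b : s \in simple -> pos b -> b != s ->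
  exists t, [/\ t \in simple, t != s & 0 < cf b t].
Proof.
move=> Hs Hb nbs.
have [/existsP[t /and3P[Ht nts Hc]]|H0] :=
    boolP [exists t, [&& t \in simple, t != s & 0 < cf b t]].
  by exists t.
have E : root b = (cf b s)%:~R *: root s.
  rewrite {1}cfE (bigD1 s) //= big1 ?addr0 // => t /andP[Ht nts].
  have := pos_cf Hb Ht; move/existsPn/(_ t): H0; rewrite Ht nts /= => H1 H2.
  have -> : cf b t = 0 by lia.
  by rewrite scale0r.
case: HPhi => _ [_ _ /(_ _ _ _ E)] [] Ec; move: E; rewrite Ec.
  by rewrite scale1r => /root_inj e; rewrite e eqxx in nbs.
rewrite scaleN1r -root_neg => /root_inj e.
by move: Hb; rewrite e posN_neg simple_pos.
Qed.

(** Some coefficient of [b] away from [s] is positive, and the reflection in [s] leaves it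
    unchanged. *)
Lemma sref_simple_pos s b : s \in simple -> pos b -> b != s -> pos (s_ s b).
Proof.
move=> Hs Hb nbs; have [t [Ht nts Hc]] := pos_cf_other Hs Hb nbs.
apply: (@pos_cfP _ t) => //; rewrite cf_sref // (cf_simple Hs Ht) eq_sym (negPf nts).
by rewrite mulr0 subr0.
Qed.

(** The root [s_ t s] has coefficient 1 at [s], hence is positive; its coefficient at [t] is
    [- cr s t]. *)
Lemma cr_simple_le0 s t : s \in simple -> t \in simple -> s != t -> cr s t <= 0.
Proof.
move=> Hs Ht nst.
have : 0 < cf (s_ t s) s.
  by rewrite cf_sref // !cf_simple // eqxx eq_sym (negPf nst) mulr0.
move=> /(pos_cfP Hs)/pos_cf/(_ t Ht); rewrite cf_sref // !cf_simple // (negPf nst) eqxx.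
by rewrite mulr1; lia.
Qed.

Lemma pair_cf x b : pairR x b = \sum_(s in simple) cf b s * pairR x s.
Proof.
have := @pair_rel x (fun d => (d == b)%:R - (if d \in simple then cf b d else 0)).
under eq_bigr do rewrite rmorphB scalerBl.
rewrite sumrB (bigD1 b) //= eqxx scale1r big1 ?addr0; last first.
  by move=> d /negPf->; rewrite scale0r.
have -> : \sum_(d : I) (if d \in simple then cf b d else 0)%:~R *: root d = root b.
  rewrite [RHS]cfE [RHS]big_mkcond; apply: eq_bigr => d _.
  by case: ifP; rewrite ?scale0r.
rewrite subrr => /(_ erefl).
under eq_bigr do rewrite mulrBl.
rewrite sumrB (bigD1 b) //= eqxx mul1r big1 ?addr0; last first.
  by move=> d /negPf->; rewrite mul0r.
move=> /eqP; rewrite subr_eq0 => /eqP ->; rewrite [RHS]big_mkcond.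
by apply: eq_bigr => d _; case: ifP; rewrite ?mul0r.
Qed.

Lemma exists_simple_cr b : pos b -> exists2 s, s \in simple & 0 < cr b s.
Proof.
move=> Hb.
have [/existsP[s /andP[Hs H]]|H0] := boolP [exists s, (s \in simple) && (0 < cr b s)].
  by exists s.
have := cr_diag b; rewrite /cr pair_cf => E.
have : \sum_(s in simple) cf b s * pairR (corX b) s <= 0.
  apply: sumr_le0 => s Hs; apply: mulr_ge0_le0; first exact: pos_cf.
  rewrite leNgt; apply/negP => /cr_gt0_sym H1.
  by move/existsPn/(_ s): H0; rewrite Hs H1.
by rewrite E.
Qed.

(** Induction on the height: [exists_simple_cr] provides a simple reflection that lowers it and
    keeps the root positive. *)
Lemma pos_ind (P : I -> Prop) :
  (forall s, s \in simple -> P s) ->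
  (forall s b, s \in simple -> pos b -> 0 < cr (s_ s b) s -> P b -> P (s_ s b)) ->
  forall b, pos b -> P b.
Proof.
move=> Psimple Pstep b.
have [k] := ubnP `|ht b|%N; elim: k b => // k IH b lek Hb.
have [s Hs Hc] := exists_simple_cr Hb.
have [->|nbs] := eqVneq b s; first exact: Psimple.
have Hb' := sref_simple_pos Hs Hb nbs.
rewrite -(sref_invol s b); apply: Pstep; rewrite ?sref_invol //.
apply: IH => //; move: Hb Hb'; rewrite !pos_ht ht_sref (simple_ht Hs) mulr1 => H1 H2.
by move: lek; lia.
Qed.

Lemma corX_simple b : pos b ->
  exists c : I -> nat, corX b = \sum_(s in simple) corX s *+ c s.
Proof.
have delta s k : s \in simple ->
    \sum_(t in simple) corX t *+ (if t == s then k else 0) = corX s *+ k.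
  move=> Hs; rewrite (bigD1 s) //= eqxx big1 ?addr0 // => t /andP[_ /negPf->].
  by rewrite mulr0n.
move: b; apply: pos_ind => [s Hs|s b Hs Hb Hc [c Hcb]].
  by exists (fun t => if t == s then 1 else 0)%N; rewrite delta.
exists (fun t => c t + (if t == s then `|cr s b|%N else 0))%N.
under eq_bigr do rewrite mulrnDr.
rewrite big_split /= -Hcb delta // corX_sref; congr (_ + _).
move: Hc; rewrite cr_srefl cr_diag => Hc.
have {}Hc : 0 < - cr b s by lia.
have : cr s b <= 0.
  have := @cr_gt0_sym (neg s) b; have := @cr_gt0_sym b (neg s).
  rewrite cr_negl cr_negr; lia.
by move=> H; rewrite -mulrNz pmulrn lez0_abs.
Qed.

Lemma leX_refl x : leX x x.
Proof. by exists (fun=> 0%N); rewrite subrr big1 // => a _; rewrite mulr0n. Qed.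

Lemma leX_trans x y z : leX x y -> leX y z -> leX x z.
Proof.
move=> [c Hc] [d Hd]; exists (fun a => c a + d a)%N.
under eq_bigr do rewrite mulrnDr.
by rewrite big_split /= -Hc -Hd addrC subrKA.
Qed.

Lemma leX_shift x y x' y' : y - x = y' - x' -> leX x y -> leX x' y'.
Proof. by move=> E [c Hc]; exists c; rewrite -E. Qed.

Lemma leXD x y z t : leX x y -> leX z t -> leX (x + z) (y + t).
Proof.
move=> H1 H2; apply: (@leX_trans _ (y + z)).
  by apply: leX_shift H1; rewrite opprD addrACA subrr addr0.
by apply: leX_shift H2; rewrite opprD addrACA subrr add0r.
Qed.

Lemma leX_cor x a (m : int) : pos a -> 0 <= m -> leX x (x + corX a *~ m).
Proof.
move=> Ha Hm; exists (fun b => if b == a then `|m|%N else 0%N).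
rewrite (bigD1 a) //= eqxx big1 ?addr0; first by rewrite addrC addKr pmulrn gez0_abs.
by move=> b /andP[_ /negPf->].
Qed.

Lemma leX_simple x y : leX x y <->
  exists c : I -> nat, y - x = \sum_(s in simple) corX s *+ c s.
Proof.
split=> [[c ->]|[c Hc]].
  have H b : exists d : I -> nat, pos b -> corX b = \sum_(s in simple) corX s *+ d s.
    have [/corX_simple[d Hd]|] := boolP (pos b); first by exists d.
    by exists (fun=> 0%N).
  have [d Hd] := choice H.
  exists (fun s => \sum_(a | pos a) d a s * c a)%N.
  under [RHS]eq_bigr do rewrite -sumrMnr.
  rewrite exchange_big /=; apply: eq_bigr => a Ha.
  rewrite {1}(Hd a Ha) -sumrMnl; apply: eq_bigr => s _.
  by rewrite mulrnA.
exists (fun b => if b \in simple then c b else 0%N); rewrite Hc.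
rewrite [LHS]big_mkcond [RHS]big_mkcond; apply: eq_bigr => a _.
by case: ifP => [/simple_pos->|] //; case: ifP.
Qed.

(* Distinct simple roots pair non-positively, so only the coefficient of
   [corX a] can make the pairing with [a] positive. *)
Lemma leX_simple_cor x y a : a \in simple -> leX x y ->
  pairR x a < pairR y a -> leX (x + corX a) y.
Proof.
move=> Ha /leX_simple[c Hc] Hlt.
have Hca : (0 < c a)%N.
  rewrite lt0n; apply/eqP => c0.
  have : pairR (y - x) a <= 0.
    rewrite Hc pairR_sum; apply: sumr_le0 => s Hs; rewrite pairRMn.
    have [->|nsa] := eqVneq s a; first by rewrite c0.
    by rewrite mulrn_wle0 // cr_simple_le0 // eq_sym.
  by rewrite pairRB; lia.
apply/leX_simple; exists (fun s => if s == a then (c s).-1 else c s).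
rewrite opprD addrA Hc !(bigD1 a Ha) /= eqxx -[c a in LHS]prednK // mulrS.
rewrite -(addrA (corX a)) addrAC subrr add0r; congr (_ + _).
by apply: eq_bigr => s /andP[_ /negPf->].
Qed.

(** * The Weyl group and simple affine reflections *)

Lemma WmulE (u v : W) j : Wmul u v j = u (v j).
Proof. by rewrite ffunE. Qed.

Lemma W1E j : W1 N j = j.
Proof. by rewrite ffunE. Qed.

Lemma WmulA (u v w : W) : Wmul u (Wmul v w) = Wmul (Wmul u v) w.
Proof. by apply/ffunP => j; rewrite !WmulE. Qed.

Lemma Wmul1 (u : W) : Wmul u (W1 N) = u.
Proof. by apply/ffunP => j; rewrite !WmulE W1E. Qed.

Lemma W1mul (u : W) : Wmul (W1 N) u = u.
Proof. by apply/ffunP => j; rewrite !WmulE W1E. Qed.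

Lemma Wmul_sref2 (u : W) a : Wmul (Wmul u (s_ a)) (s_ a) = u.
Proof. by apply/ffunP => j; rewrite !WmulE sref_invol. Qed.

Lemma srefN a : s_ (neg a) = s_ a.
Proof. by apply/ffunP => b; exact: sref_neg. Qed.

Definition aut (w : W) :=
  [/\ injective w, forall a b, cr (w a) (w b) = cr a b
    & forall a b, w (s_ a b) = s_ (w a) (w b)].

Lemma aut_sref c : aut (s_ c).
Proof.
split=> [|a b|a b]; [exact: sref_inj|by rewrite cr_sref sref_invol|exact: sref_sref].
Qed.

Lemma prodW_cat s t : prodW (s ++ t) = Wmul (prodW s) (prodW t).
Proof. by elim: s => [|a s IH] /=; rewrite ?W1mul // IH WmulA. Qed.

Lemma inW1 : inW (W1 N).
Proof. by exists [::]. Qed.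

Lemma inWM u v : inW u -> inW v -> inW (Wmul u v).
Proof.
move=> [s [Hs <-]] [t [Ht <-]]; exists (s ++ t); rewrite prodW_cat; split=> //.
by rewrite /simple_word all_cat; apply/andP.
Qed.

Lemma inW_simple s : s \in simple -> inW (s_ s).
Proof. by move=> Hs; exists [:: s]; rewrite /= andbT Wmul1. Qed.

Lemma inW_aut w : inW w -> aut w.
Proof.
move=> [s [_ <-]]; elim: s => [|a s [IH1 IH2 IH3]] /=.
  by split=> [a b|a b|a b]; rewrite !W1E.
have [A1 A2 A3] := aut_sref a.
split=> [b c|b c|b c]; rewrite !WmulE; first by move/A1/IH1.
  by rewrite A2 IH2.
by rewrite IH3 A3.
Qed.

Lemma inW_inj w : inW w -> injective w.
Proof. by case/inW_aut. Qed.

Lemma inW_cr w a b : inW w -> cr (w a) (w b) = cr a b.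
Proof. by case/inW_aut. Qed.

Lemma inW_s w a b : inW w -> w (s_ a b) = s_ (w a) (w b).
Proof. by case/inW_aut. Qed.

Lemma inW_neg w a : inW w -> w (neg a) = neg (w a).
Proof. exact: inW_s. Qed.

Lemma WmulsE w a : inW w -> Wmul w (s_ a) = Wmul (s_ (w a)) w.
Proof. by move=> Hw; apply/ffunP => j; rewrite !WmulE inW_s. Qed.

Lemma Winv_l w j : inW w -> Winv w (w j) = j.
Proof.
move=> /inW_inj inj; rewrite ffunE; case: pickP => [k /eqP/inj //|/(_ j)].
by rewrite eqxx.
Qed.

Lemma Winv_r w j : inW w -> w (Winv w j) = j.
Proof.
move=> /inW_inj inj; rewrite ffunE; case: pickP => [k /eqP //|/(_ (invF inj j))].
by rewrite f_invF eqxx.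
Qed.

Lemma Winv_uniq (w v : W) : inW w -> (forall j, w (v j) = j) -> Winv w = v.
Proof.
by move=> Hw H; apply/ffunP => j; apply: (inW_inj Hw); rewrite Winv_r.
Qed.

Lemma inWV w : inW w -> inW (Winv w).
Proof.
move=> Hw; case: (Hw) => s [Hs E]; exists (rev s); split.
  by rewrite /simple_word all_rev.
apply/esym/Winv_uniq => // j; rewrite -E.
elim: s {Hs E} j => [|a s IH] j /=; first by rewrite /= !W1E.
by rewrite rev_cons -cats1 prodW_cat /= Wmul1 !WmulE IH sref_invol.
Qed.

Lemma inW_sref a : inW (s_ a).
Proof.
have Hpos : forall b, pos b -> inW (s_ b).
  apply: pos_ind => [s|s b Hs Hb _ IH]; first exact: inW_simple.
  have -> : s_ (s_ s b) = Wmul (s_ s) (Wmul (s_ b) (s_ s)).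
    by apply/ffunP => j; rewrite !WmulE [RHS]sref_sref sref_invol.
  by apply: inWM; [|apply: inWM]; rewrite ?IH //; exact: inW_simple.
have [/Hpos//|] := boolP (pos a); rewrite -posN_neg => /Hpos.
by rewrite srefN.
Qed.

Lemma Winv_neg w a : inW w -> Winv w (neg a) = neg (Winv w a).
Proof. by move=> Hw; rewrite inW_neg //; exact: inWV. Qed.

(* [sref g] followed by the translation by [thr g] times the coroot is the
   affine reflection in the lowest positive affine root of direction [g]; the
   positive affine roots (e, k) that it makes negative number [es g e] when
   [es g e >= 0].  It is a simple affine reflection when [asimple g]. *)
Definition es (g e : I) : int := thr g * cr e g + thr (s_ g e) - thr e.

Definition asimple (g : I) : Prop := forall e, e != g -> e != neg g -> es g e = 0.

Lemma es_diag g : es g g = 1.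
Proof. by rewrite /es cr_diag -/(neg g) thr_neg; lia. Qed.

Lemma es_neg g e : es g (neg e) = - es g e.
Proof. by rewrite /es cr_negl sref_negr !thr_neg; lia. Qed.

Lemma es_sref g e : es g (s_ g e) = - es g e.
Proof. by rewrite /es cr_srefl cr_diag sref_invol; lia. Qed.

Lemma asimple_simple s : s \in simple -> asimple s.
Proof.
move=> Hs e n1 n2; rewrite /es thr_pos ?simple_pos // mul0r add0r.
have [He|] := boolP (pos e); first by rewrite !thr_pos ?subrr // sref_simple_pos.
rewrite -posN_neg => He.
have : pos (s_ s (neg e)).
  by apply: sref_simple_pos => //; apply: contra n2 => /eqP <-; rewrite negK.
by rewrite sref_negr => /thr_pos; move/thr_pos: He; rewrite !thr_neg; lia.
Qed.

(** As [g] is [asimple], the only surviving term is that of the positive root which [u] sends to [g]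
    or [neg g]. *)
Lemma sum_es g u : asimple g -> inW u ->
  \sum_(b | pos b) es g (u b) = if pos (Winv u g) then 1 else -1.
Proof.
move=> Hg Hu.
have H d : pos d -> u d = g \/ u d = neg g ->
    \sum_(b | pos b) es g (u b) = es g (u d).
  move=> Hd Ed; rewrite (bigD1 d) //= big1 ?addr0 // => b /andP[Hb nbd].
  have nb : b != neg d by apply: contraTneq Hb => ->; rewrite posN_neg Hd.
  have inj := inj_eq (inW_inj Hu).
  case: Ed => Ed; apply: Hg.
  - by rewrite -Ed inj.
  - by rewrite -Ed -inW_neg // inj.
  - have -> : g = u (neg d) by rewrite inW_neg // Ed negK.
    by rewrite inj.
  - by rewrite -Ed inj.
have [Hp|Hn] := boolP (pos (Winv u g)).
  by rewrite (H _ Hp) Winv_r ?es_diag //; left.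
have Hp : pos (Winv u (neg g)) by rewrite Winv_neg // posN_neg.
by rewrite (H _ Hp) Winv_r ?es_neg ?es_diag //; right.
Qed.

(** The number of inversions of [w], since [thr] is 1 exactly on negative roots; [coxlenE]
    identifies it with the Coxeter length. *)
Definition linv (w : W) : int := \sum_(b | pos b) thr (w b).

Lemma linv_left s w : s \in simple -> inW w ->
  linv (Wmul (s_ s) w) = linv w + if pos (Winv w s) then 1 else -1.
Proof.
move=> Hs Hw; rewrite -(sum_es (asimple_simple Hs) Hw) /linv -big_split /=.
apply: eq_bigr => b _; rewrite WmulE /es (thr_pos (simple_pos Hs)); lia.
Qed.

Lemma linv_ge0 w : 0 <= linv w.
Proof. by apply: sumr_ge0 => b _; have := thr_ht (w b); lia. Qed.

Lemma linv_prodW s : word s -> linv (prodW s) <= (size s)%:Z.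
Proof.
elim: s => [_|a s IH /= /andP[Ha Hs]].
  by rewrite /linv big1 // => b Hb; rewrite W1E thr_pos.
rewrite linv_left //; last by exists s.
by have := IH Hs; case: ifP; lia.
Qed.

(** The exchange condition. Carried back through the word, [b] ends at the negative root [d]; the
    letter at which its sign changes equals the current root and is deleted. *)
Lemma exchange s b d : word s -> pos b -> ~~ pos d -> prodW s d = b ->
  exists t, [/\ word t, (size t).+1 = size s & prodW t = Wmul (s_ b) (prodW s)].
Proof.
elim: s b => [|a s IH] b /=; first by move=> _ Hb Hd; rewrite W1E => E; rewrite -E (negPf Hd) in Hb.
move=> /andP[Ha Hs] Hb Hd E.
have [ba|nba] := eqVneq b a.
  exists s; split=> //; apply/ffunP => j; rewrite !WmulE -ba sref_invol //.
have Hb' := sref_simple_pos Ha Hb nba.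
have E' : prodW s d = s_ a b by rewrite -E WmulE sref_invol.
have [t [Ht st Et]] := IH _ Hs Hb' Hd E'.
exists (a :: t); split=> /=; [by rewrite Ha|by rewrite st|].
by apply/ffunP => j; rewrite Et !WmulE sref_sref sref_invol.
Qed.

(** A new letter changes [linv] by one; when it decreases, [exchange] supplies the shorter word. *)
Lemma word_linv w : inW w ->
  exists s, [/\ word s, (size s)%:Z = linv w & prodW s = w].
Proof.
move=> [s [Hs <-]]; elim: s Hs => [_|a s IH /= /andP[Ha Hs]].
  by exists [::]; split=> //; rewrite /linv big1 // => b Hb; rewrite W1E thr_pos.
have Hw : inW (prodW s) by exists s.
have [t [Ht st Et]] := IH Hs; rewrite linv_left //.
have [Hp|Hn] := ifPn.
  exists (a :: t); split=> /=; [by rewrite Ha|by lia|by rewrite Et].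
have [//|||r [Hr sr Er]] := @exchange t a (Winv (prodW s) a) Ht.
- exact: simple_pos.
- exact: Hn.
- by rewrite Et Winv_r.
by exists r; split; [|move: st sr; lia|rewrite Er Et].
Qed.

Lemma linv_le w : linv w <= N%:Z.
Proof.
apply: (@le_trans _ _ (\sum_(b | pos b) 1)).
  by apply: ler_sum => b _; have := thr_ht (w b); lia.
rewrite sumr_const; have := max_card pos; rewrite card_ord.
by rewrite -mulr_natl mulr1 natz.
Qed.

Lemma leq_expNN : (N <= N ^ N)%N.
Proof. by case: (N) => // m; rewrite -{1}[m.+1]expn1 leq_pexp2l. Qed.

Lemma has_wordP w m :
  reflect (exists s, [/\ word s, size s = m & prodW s = w]) (has_word root coroot simple w m).
Proof.
apply: (iffP existsP) => [[t /andP[Ht /eqP E]]|[s [Hs sm E]]].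
  by exists t; rewrite size_tuple.
have H : size s == m by apply/eqP.
by exists (Tuple H); rewrite Hs E eqxx.
Qed.

Lemma find_iota (P : pred nat) m k : P k -> (k <= m)%N -> (forall j, P j -> (k <= j)%N) ->
  find P (iota 0 m.+1) = k.
Proof.
move=> Pk km kmin.
have Hs : has P (iota 0 m.+1) by apply/hasP; exists k => //; rewrite mem_iota /= ltnS.
apply/eqP; rewrite eqn_leq; apply/andP; split.
  rewrite leqNgt; apply/negP => H.
  by have := before_find 0%N H; rewrite nth_iota ?add0n ?Pk // ltnS.
have := nth_find 0%N Hs; rewrite nth_iota ?add0n; first exact: kmin.
by move: Hs; rewrite has_find size_iota.
Qed.

Lemma coxlenE w : inW w -> (coxlen w)%:Z = linv w.
Proof.
move=> Hw; have [s [Hs ss Es]] := word_linv Hw.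
suff -> : coxlen w = size s by [].
apply: find_iota; first by apply/has_wordP; exists s.
  by apply: leq_trans leq_expNN; have := linv_le w; lia.
by move=> j /has_wordP[t [Ht <- Et]]; have := linv_prodW Ht; rewrite Et -ss.
Qed.

Lemma redwordP w : inW w ->
  word (redword root coroot simple w) /\ prodW (redword root coroot simple w) = w.
Proof.
move=> Hw; rewrite /redword; case: pickP => [t /andP[Ht /eqP] //|H].
have [s [Hs ss Es]] := word_linv Hw.
have Hsz : size s == coxlen w by rewrite -eqz_nat coxlenE // -ss.
by have := H (Tuple Hsz); rewrite Hs Es eqxx.
Qed.

(** By [inQ_ext] these two properties determine the result, so the action does not depend on the
    reduced word chosen in [actW]. *)
Lemma foldr_reflX s mu : inQ (foldr reflX mu s - mu) /\
  forall b, pairR (foldr reflX mu s) (prodW s b) = pairR mu b.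
Proof.
elim: s => [|a s [IH1 IH2]] /=.
  by split=> [|b]; rewrite ?subrr ?W1E //; exact: inQ0.
split=> [|b].
  by rewrite /Defs.reflX addrAC; apply: inQD => //; apply/inQN/inQ_cor.
rewrite WmulE pairRB pairRMz -/(cr _ _) [X in _ - X]mulrC -pair_sref sref_invol.
exact: IH2.
Qed.

(** The action of the inverse of [v], the form in which the product of the semidirect product uses
    it. *)
Definition iact (v : W) (mu : X) : X := actW (Winv v) mu.

Lemma iact_pair v mu b : inW v -> pairR (iact v mu) b = pairR mu (v b).
Proof.
move=> Hv; have [_ E] := redwordP (inWV Hv).
have [_ H] := foldr_reflX (redword root coroot simple (Winv v)) mu.
by rewrite -(H (v b)) E Winv_l.
Qed.

Lemma iact_Q v mu : inQ (iact v mu - mu).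
Proof. by have [] := foldr_reflX (redword root coroot simple (Winv v)) mu. Qed.

Lemma iact_uniq v mu x : inW v -> inQ (x - mu) ->
  (forall b, pairR x b = pairR mu (v b)) -> iact v mu = x.
Proof.
move=> Hv Hx H; apply: inQ_ext => [|b]; last by rewrite iact_pair.
rewrite -(subrKA mu); apply: inQD; first exact: iact_Q.
by rewrite -opprB; apply: inQN.
Qed.

Lemma iactD v mu nu : inW v -> iact v (mu + nu) = iact v mu + iact v nu.
Proof.
move=> Hv; apply: iact_uniq => // [|b]; last by rewrite !pairRD !iact_pair.
by rewrite opprD addrACA; apply: inQD; exact: iact_Q.
Qed.

Lemma iact_cor v a k : inW v -> iact v (corX (v a) *~ k) = corX a *~ k.
Proof.
move=> Hv; apply: iact_uniq => // [|b].
  by apply: inQD; [|apply: inQN]; exact: inQ_cor.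
by rewrite !pairRMz -!/(cr _ _) inW_cr.
Qed.

Lemma iactM u v mu : inW u -> inW v -> iact (Wmul u v) mu = iact v (iact u mu).
Proof.
move=> Hu Hv; apply: iact_uniq => [||b]; first exact: inWM.
  by rewrite -(subrKA (iact u mu)); apply: inQD; exact: iact_Q.
by rewrite !iact_pair // WmulE.
Qed.

Lemma iact_sref a mu : iact (s_ a) mu = mu - corX a *~ pairR mu a.
Proof.
apply: iact_uniq => [||b]; first exact: inW_sref.
  by rewrite addrC addKr; apply/inQN/inQ_cor.
by rewrite pairRB pairRMz pair_sref mulrC.
Qed.

(** Right multiplication by the affine reflection in the affine root that [y] sends to [(y.1 a, m)];
    see [mul_affrefl]. Indexed in this way, positivity of the image reads [thr (y.1 a) <= m]. *)
Definition rf (y : Wa) a (m : int) : Wa := (Wmul y.1 (s_ a), y.2 + corX a *~ m).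

Lemma rf_neg y a m : rf y (neg a) m = rf y a (- m).
Proof. by rewrite /rf srefN corX_neg mulNrz mulrNz. Qed.

Lemma rfK y a m : rf (rf y a m) a (- m) = y.
Proof. by case: y => u nu; rewrite /rf /= Wmul_sref2 mulrNz addrK. Qed.

Lemma inW_rf y a m : inW y.1 -> inW (rf y a m).1.
Proof. by move=> Hy; apply: inWM => //; exact: inW_sref. Qed.

Lemma affmulE (x y : Wa) : x ** y = (Wmul x.1 y.1, iact y.1 x.2 + y.2).
Proof. by []. Qed.

Lemma inW_mul (x y : Wa) : inW x.1 -> inW y.1 -> inW (x ** y).1.
Proof. exact: inWM. Qed.

Lemma mul_rf_r (x z : Wa) e m : inW z.1 ->
  x ** rf z e m = rf (x ** z) e (m - pairR x.2 (z.1 e)).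
Proof.
move=> Hz; rewrite affmulE /rf /= WmulA iactM //; last exact: inW_sref.
congr pair; rewrite -/(iact _ _) iact_sref iact_pair // mulrzBr -!addrA; congr (_ + _).
by rewrite addrC -addrA.
Qed.

Lemma mul_rf_l (x z : Wa) e m : inW x.1 -> inW z.1 ->
  rf x (z.1 e) m ** z = rf (x ** z) e m.
Proof.
move=> Hx Hz; rewrite affmulE /rf /= -!WmulA -WmulsE //; congr pair.
by rewrite iactD // iact_cor // addrAC.
Qed.

Lemma mul_affrefl (x : Wa) a k :
  x ** affrefl root coroot corX a k = rf x a (k - pairR x.2 a).
Proof.
rewrite affmulE /rf /=; congr pair.
by rewrite iact_sref mulrzBr -addrA; congr (_ + _); rewrite addrC.
Qed.

Lemma mul_cancel (x y z : Wa) : inW z.1 -> x ** z = y ** z -> x = y.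
Proof.
case: x y z => [w mu] [w' mu'] [v la] /= Hv; rewrite !affmulE /= => -[E1 /addIr E2].
have Ew : w = w'.
  apply/ffunP => j; have := congr1 (fun f : W => f (Winv v j)) E1.
  by rewrite !WmulE Winv_r.
congr pair => //; apply: inQ_ext => [|e].
  rewrite -(subrKA (iact v mu)); apply: inQD; last by rewrite E2; exact: iact_Q.
  by rewrite -opprB; apply/inQN/iact_Q.
have := congr1 (fun x => pairR x (Winv v e)) E2.
by rewrite !iact_pair // Winv_r.
Qed.

(* The inversions of [x] in direction [b], counted with sign. *)
Definition ell (x : Wa) (b : I) : int := pairR x.2 b + thr (x.1 b) - thr b.

Lemma ell_neg x b : inW x.1 -> ell x (neg b) = - ell x b.
Proof. by move=> Hx; rewrite /ell pair_neg inW_neg // !thr_neg; lia. Qed.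

Lemma ell_mul (x y : Wa) b : inW y.1 -> ell (x ** y) b = ell x (y.1 b) + ell y b.
Proof.
by move=> Hy; rewrite /ell affmulE /= -/(iact _ _) pairRD iact_pair // WmulE; lia.
Qed.

Lemma ell_rf y a m b :
  ell (rf y a m) b = ell y b + (m * cr b a + thr (y.1 (s_ a b)) - thr (y.1 b)).
Proof. by rewrite /ell /rf /= pairRD pairRMz -/(cr _ _) WmulE; lia. Qed.

Definition lsi (y : Wa) : int := \sum_(b | pos b) ell y b.

(** The change [F] of [ell] is odd under [s_ a], so the roots that [s_ a] keeps positive cancel out.
    The remaining ones are the inversions of [s_ a]: each contributes a nonnegative amount, and [a]
    itself at least 1. *)
Lemma lsi_rf y a m : inW y.1 -> pos a -> thr (y.1 a) <= m -> lsi y < lsi (rf y a m).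
Proof.
move=> Hy Ha Hm.
pose F g := m * cr g a + thr (y.1 (s_ a g)) - thr (y.1 g).
have FN g : F (s_ a g) = - F g by rewrite /F cr_srefl cr_diag sref_invol; lia.
have -> : lsi (rf y a m) = lsi y + \sum_(g | pos g) F g.
  by rewrite /lsi -big_split /=; apply: eq_bigr => g _; rewrite ell_rf.
rewrite (bigID (fun g => pos (s_ a g))) /=.
have -> : \sum_(g | pos g && pos (s_ a g)) F g = 0.
  suff : \sum_(g | pos g && pos (s_ a g)) F g = - \sum_(g | pos g && pos (s_ a g)) F g.
    lia.
  rewrite {1}(reindex_inj (@sref_inj a)) -sumrN.
  by apply: eq_big => [g|g _]; rewrite ?sref_invol // andbC.
rewrite add0r (bigD1 a) /=; last by rewrite Ha -/(neg a) posN_neg Ha.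
have Fa : 1 <= F a.
  by rewrite /F cr_diag -/(neg a) inW_neg // thr_neg; lia.
rewrite ltrDl; apply: ltr_pwDl; first by lia.
apply: sumr_ge0 => g /andP[/andP[Hg Hn] _].
have {}Ha : 0 < ht a by rewrite -pos_ht.
move: Hg Hn; rewrite !pos_ht ht_sref => Hg Hn.
have c1 : 1 <= cr g a by nia.
rewrite /F; have := thr_ht (y.1 g); have := thr_ht (y.1 (s_ a g)).
have := thr_ht (y.1 a).
rewrite inW_s // ht_sref inW_cr //; set c := cr g a in c1 *.
move=> H1 H2 H3.
(* If [m = 0], then [y.1 a] is positive, and [y.1 (s_ a g)] is [y.1 g] minus a positive multiple of
   it, so [thr] cannot drop. *)
have [m1|m1] : 1 <= m \/ m = 0 by lia.
  have : 1 <= m * c by nia.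
  lia.
have : 0 < ht (y.1 a) -> 0 <= c * ht (y.1 a) by nia.
rewrite m1 in Hm *; lia.
Qed.

Definition sa (g : I) : Wa := (s_ g, corX g *~ thr g).

Lemma ell_sa g e : ell (sa g) e = es g e.
Proof. by rewrite /ell /sa /= pairRMz. Qed.

(* Left multiplication by [sa g]. *)
Definition lsm (g : I) (y : Wa) : Wa := rf y (Winv y.1 g) (thr g).

Lemma lsm1 g y : inW y.1 -> (lsm g y).1 = Wmul (s_ g) y.1.
Proof. by move=> Hy; rewrite /lsm /= WmulsE // Winv_r. Qed.

Lemma inW_lsm g y : inW y.1 -> inW (lsm g y).1.
Proof. exact: inW_rf. Qed.

Lemma Winv_lsm g y e : inW y.1 -> Winv (lsm g y).1 e = Winv y.1 (s_ g e).
Proof.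
move=> Hy; have Hs := inW_lsm g Hy; apply: (inW_inj Hs); rewrite Winv_r //.
by rewrite lsm1 // WmulE Winv_r // sref_invol.
Qed.

Lemma lsmK g y : inW y.1 -> lsm g (lsm g y) = y.
Proof.
by move=> Hy; rewrite {1}/lsm Winv_lsm // -/(neg g) Winv_neg // rf_neg rfK.
Qed.

Lemma lsm_mul g x z : inW x.1 -> inW z.1 -> lsm g (x ** z) = lsm g x ** z.
Proof.
move=> Hx Hz; have Hxz := inW_mul Hx Hz.
have E : Winv x.1 g = z.1 (Winv (x ** z).1 g).
  by apply: (inW_inj Hx); rewrite Winv_r // -(WmulE x.1) (Winv_r _ Hxz).
by rewrite {2}/lsm E mul_rf_l.
Qed.

Lemma ell_lsm g y b : inW y.1 -> ell (lsm g y) b = ell y b + es g (y.1 b).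
Proof.
move=> Hy; rewrite /lsm ell_rf inW_s // /es -(inW_cr b _ Hy) Winv_r //; lia.
Qed.

Lemma lsi_lsm g y : asimple g -> inW y.1 ->
  lsi (lsm g y) = lsi y + if pos (Winv y.1 g) then 1 else -1.
Proof.
move=> Hg Hy; rewrite -(sum_es Hg Hy) /lsi -big_split /=.
by apply: eq_bigr => b _; rewrite ell_lsm.
Qed.

(** * The semi-infinite order *)

Inductive star (R : Wa -> Wa -> Prop) (x : Wa) : Wa -> Prop :=
| star_refl : star R x x
| star_step y z : star R x y -> R y z -> star R x z.

Lemma star_trans R x y z : star R x y -> star R y z -> star R x z.
Proof. by move=> H; elim=> // t u _ IH; apply: star_step. Qed.

Lemma star1 (R : Wa -> Wa -> Prop) x y : R x y -> star R x y.
Proof. by move=> H; apply: star_step H; exact: star_refl. Qed.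

(* The closure of [sstep] is the semi-infinite Bruhat order on W x X. *)
Definition sstep (y y' : Wa) : Prop :=
  exists a m, [/\ pos a, thr (y.1 a) <= m & y' = rf y a m].

Local Notation sle := (star sstep).

(** Both the affine root [(a, m + pairR x.2 a)] of the reflection and its image under [x] are
    positive. In [sstep] the first condition is replaced by positivity of the finite root [a]. *)
Definition bstep (x x' : Wa) : Prop :=
  exists a m, [/\ thr a <= m + pairR x.2 a, thr (x.1 a) <= m & x' = rf x a m].

Lemma rf_comm y a d m t :
  rf (rf y a m) (s_ a d) t = rf (rf y d t) a (m - t * cr a d).
Proof.
rewrite /rf /= corX_sref; congr pair.
  by apply/ffunP => j; rewrite !WmulE sref_sref sref_invol.
rewrite -!addrA; congr (_ + _).
by rewrite mulrzBl mulrzBr -mulrzA [cr a d * t]mulrC addrCA.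
Qed.

(** A simple affine reflection permutes the positive affine roots other than its own, so left
    multiplication by it preserves a step unless the step is that reflection itself. The last
    equation says that the affine root reflected on the right stays the same, which [bstep]
    needs. *)
Lemma left_rf g y a m : asimple g -> inW y.1 -> thr (y.1 a) <= m ->
  rf y a m = lsm g y \/
  exists m', [/\ thr ((lsm g y).1 a) <= m', lsm g (rf y a m) = rf (lsm g y) a m'
    & m' + pairR (lsm g y).2 a = m + pairR y.2 a].
Proof.
move=> Hg Hy Hm; set d := Winv y.1 g; have yd : y.1 d = g by rewrite Winv_r.
have E : lsm g (rf y a m) = rf (lsm g y) a (m - thr g * cr a d).
  rewrite /lsm -rf_comm; congr rf.
  have Hr := inW_rf a m Hy; apply: (inW_inj Hr); rewrite Winv_r //.
  by rewrite WmulE sref_invol yd.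
have Em : m - thr g * cr a d + pairR (lsm g y).2 a = m + pairR y.2 a.
  by rewrite /lsm /= -/d pairRD pairRMz -/(cr _ _); lia.
have Hc : cr a d = cr (y.1 a) g by rewrite -yd inW_cr.
have El : (lsm g y).1 a = s_ g (y.1 a) by rewrite lsm1 // WmulE.
have [ag|nag] := eqVneq (y.1 a) g.
  have ad : a = d by apply: (inW_inj Hy); rewrite yd.
  have [mt|nmt] := eqVneq m (thr g); first by left; rewrite mt ad.
  right; exists (m - thr g * cr a d); split=> //.
  rewrite El Hc ag cr_diag -/(neg g) thr_neg; move: Hm nmt; rewrite ag.
  by move=> H1 /eqP H2; have := thr_ht g; lia.
right; exists (m - thr g * cr a d); split=> //; rewrite El Hc.
have [an|nan] := eqVneq (y.1 a) (neg g).
  move: Hm; rewrite an cr_negl cr_diag sref_negr negK thr_neg.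
  by have := thr_ht g; lia.
by have := Hg _ nag nan; rewrite /es; lia.
Qed.

Lemma left_sstep g y y1 : asimple g -> inW y.1 -> sstep y y1 ->
  y1 = lsm g y \/ sstep (lsm g y) (lsm g y1).
Proof.
move=> Hg Hy [a [m [Ha Hm ->]]].
have [->|[m' [H1 -> _]]] := left_rf Hg Hy Hm; [by left|right].
by exists a, m'.
Qed.

Lemma left_bstep g x x1 : asimple g -> inW x.1 -> bstep x x1 ->
  x1 = lsm g x \/ bstep (lsm g x) (lsm g x1).
Proof.
move=> Hg Hy [a [m [Ha Hm ->]]].
have [->|[m' [H1 -> E]]] := left_rf Hg Hy Hm; [by left|right].
by exists a, m'; rewrite E.
Qed.

Lemma inW_sstep y y' : sstep y y' -> inW y.1 <-> inW y'.1.
Proof.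
move=> [a [m [_ _ ->]]]; split; first exact: inW_rf.
by move=> H; rewrite -(rfK y a m); exact: inW_rf.
Qed.

Lemma inW_sle y y' : sle y y' -> inW y.1 <-> inW y'.1.
Proof. by elim=> // z z' _ IH /inW_sstep H; split=> [/IH/H|/H/IH]. Qed.

Lemma lsi_sstep y y' : inW y.1 -> sstep y y' -> lsi y < lsi y'.
Proof. by move=> Hy [a [m [Ha Hm ->]]]; exact: lsi_rf. Qed.

Lemma lsi_sle y y' : inW y.1 -> sle y y' -> y = y' \/ lsi y < lsi y'.
Proof.
move=> Hy; elim=> [|z z' Hz IH Hs]; first by left.
right; have Hz1 : inW z.1 by apply/(inW_sle Hz).
by have := lsi_sstep Hz1 Hs; case: IH => [->|] //; exact: lt_trans.
Qed.

Lemma lsi_sle_le y y' : inW y.1 -> sle y y' -> lsi y <= lsi y'.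
Proof. by move=> Hy /(lsi_sle Hy) [->//|/ltW]. Qed.

Lemma lsm_up g y : inW y.1 -> pos (Winv y.1 g) -> sstep y (lsm g y).
Proof. by move=> Hy Hp; exists (Winv y.1 g), (thr g); rewrite Winv_r. Qed.

Lemma lsm_down g y : inW y.1 -> ~~ pos (Winv y.1 g) -> sstep (lsm g y) y.
Proof.
move=> Hy Hp; rewrite -{2}(lsmK g Hy); apply: lsm_up; first exact: inW_lsm.
by rewrite Winv_lsm // -/(neg g) Winv_neg // posN_neg.
Qed.

(** Left multiplication carries the chain over step by step, until a step is the reflection itself;
    from there on the old chain is followed. *)
Lemma lift1 g y y' : asimple g -> inW y.1 -> sle y y' ->
  sle (lsm g y) y' \/ sle (lsm g y) (lsm g y').
Proof.
move=> Hg Hy; elim=> [|z z' Hz IH Hs]; first by right; exact: star_refl.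
have Hz1 : inW z.1 by apply/(inW_sle Hz).
case: IH => IH; first by left; exact: star_step IH Hs.
by have [->|H] := left_sstep Hg Hz1 Hs; [left|right; exact: star_step IH H].
Qed.

Lemma lift2 g y y' : asimple g -> inW y.1 -> sle y y' ->
  sle y (lsm g y') \/ sle (lsm g y) (lsm g y').
Proof.
move=> Hg Hy; elim=> [|z z' Hz IH Hs]; first by right; exact: star_refl.
have Hz1 : inW z.1 by apply/(inW_sle Hz).
have [->|H] := left_sstep Hg Hz1 Hs; first by left; rewrite lsmK.
by case: IH => IH; [left|right]; exact: star_step IH H.
Qed.

Lemma sle_leX y y' : sle y y' -> leX y.2 y'.2.
Proof.
elim=> [|z z' _ IH [a [m [Ha Hm ->]]]]; first exact: leX_refl.
by apply: leX_trans IH _; apply: leX_cor => //; have := thr_ht (z.1 a); lia.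
Qed.

(** Two steps in direction [a] compose to a translation: the first at the least admissible level,
    the second making up the rest. *)
Lemma sle_cor u nu a (k : nat) : inW u -> pos a -> sle (u, nu) (u, nu + corX a *+ k).
Proof.
move=> Hu Ha; case: k => [|k]; first by rewrite addr0; exact: star_refl.
apply: (@star_trans _ _ (rf (u, nu) a (thr (u a)))).
  by apply: star1; exists a, (thr (u a)).
apply: star1; exists a, (k.+1%:Z - thr (u a)); split=> //=.
  by rewrite WmulE -/(neg a) inW_neg // thr_neg; lia.
rewrite /rf /= Wmul_sref2 -addrA -mulrzDr pmulrn; congr (_, _ + _ *~ _).
by rewrite addrC subrK.
Qed.

Lemma leX_sle u nu nu' : inW u -> leX nu nu' -> sle (u, nu) (u, nu').
Proof.
move=> Hu [c]; move/(canRL (subrK nu)); rewrite addrC => ->.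
elim/big_rec: _ => [|a x Ha IH]; first by rewrite addr0; exact: star_refl.
apply: star_trans IH _.
by rewrite [corX a *+ _ + _]addrC addrA; exact: sle_cor.
Qed.

Lemma sle_shift y y' la : sle y y' -> sle (y.1, y.2 + la) (y'.1, y'.2 + la).
Proof.
elim=> [|z z' _ IH [a [m [Ha Hm ->]]]]; first exact: star_refl.
apply: star_step IH _; exists a, m; split=> //.
by rewrite /rf /= addrAC.
Qed.

Lemma sle_shiftE u nu u' nu' la :
  sle (u, nu) (u', nu') <-> sle (u, nu + la) (u', nu' + la).
Proof.
split=> [/(sle_shift la) //|/(sle_shift (- la))] /=.
by rewrite !addrK.
Qed.

(* Strictly larger than every height, so that [k * bigM + ht b] orders the
   affine roots (b, k) compatibly with positivity. *)
Definition bigM : int := \sum_a `|ht a| + 1.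

Lemma ht_bigM a : `|ht a| < bigM.
Proof.
by rewrite /bigM (bigD1 a) //= -addrA ltrDl ltr_wpDl // sumr_ge0.
Qed.

Lemma aff_pos k b : (0 < k * bigM + ht b) = (thr b <= k).
Proof.
have := ht_bigM b; have := thr_ht b; set M := bigM; set h := ht b => H1 H2.
have [k0|[k0|k0]] : k <= -1 \/ k = 0 \/ 1 <= k by lia.
- have : k * M <= - M by nia.
  by lia.
- by rewrite k0; lia.
- have : M <= k * M by nia.
  by lia.
Qed.

(** Among the roots with [0 < ell x], take [g] whose lowest positive affine root has least height.
    If [g] were not simple, this affine root would be a sum of two positive ones; [x] makes it
    negative, hence also one of the summands, whose height is smaller. *)
Lemma simple_exists x b : inW x.1 -> 0 < ell x b ->
  exists2 g, asimple g & 0 < ell x g.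
Proof.
move=> Hx Hb0.
pose h c := thr c * bigM + ht c.
have h0 c : 0 < h c by rewrite aff_pos.
case: (@arg_minnP _ b (fun c => 0 < ell x c) (fun c => `|h c|%N) Hb0) => g Hg gmin.
exists g => // {b Hb0}.
(* [k * bigM + G c] is the height of the image of [(c, k)] under [x]. *)
pose G c := ht (x.1 c) - bigM * pairR x.2 c.
have G_sref a b : G (s_ a b) = G b - cr b a * G a.
  by rewrite /G inW_s // ht_sref inW_cr // pair_sref; ring.
have G_neg a : G (neg a) = - G a by rewrite G_sref cr_diag; lia.
have GE c k : k * bigM + G c = (k - pairR x.2 c) * bigM + ht (x.1 c).
  by rewrite /G; ring.
have Gneg c k : k * bigM + G c < 0 -> k - pairR x.2 c < thr (x.1 c).
  by rewrite GE ltNge [in X in _ -> X]ltNge -aff_pos; apply: contra => /ltW.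
have hmin c k : thr c <= k -> k * bigM + G c < 0 -> h g <= k * bigM + ht c.
  move=> Hk /Gneg Hn.
  have /gmin : 0 < ell x c by rewrite /ell; lia.
  have := h0 g; have := h0 c; have := ht_bigM c => H1 H2 H3 H4.
  have : h c <= k * bigM + ht c by rewrite lerD2r ler_pM2r //; lia.
  by lia.
have Gg : thr g * bigM + G g < 0.
  have : ~~ (thr (x.1 g) <= thr g - pairR x.2 g) by move: Hg; rewrite /ell; lia.
  rewrite -aff_pos -GE -leNgt le_eqVlt => /orP[/eqP E|//].
  have := ht_bigM (x.1 g); have := ht_neq0 (x.1 g).
  move: E; rewrite GE; move: (thr g - _) (ht _) bigM => k hh M E H1 H2.
  have [k0|[k0|k0]] : k <= -1 \/ k = 0 \/ 1 <= k by lia.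
  - have : k * M <= - M by nia.
    by lia.
  - by move: E; rewrite k0; lia.
  - have : M <= k * M by nia.
    by lia.
have nodec e f k k' : ht g = ht e + ht f -> G g = G e + G f -> k + k' = thr g ->
    thr e <= k -> thr f <= k' -> False.
  move=> Eh EG Ek Hk Hk'.
  have := hmin _ _ Hk; have := hmin _ _ Hk'.
  move: Hk Hk' Gg; rewrite -!aff_pos /h Eh EG -Ek !mulrDl; lia.
have Hpos b : b != g -> b != neg g -> 0 < cr b g -> es g b = 0.
  move=> n1 n2 Hc; set c := cr b g in Hc.
  have [//|nz] := eqVneq (es g b) 0; exfalso.
  have e1 : 1 <= es g b.
    move: nz; rewrite /es -/c; have := thr_ht g; have := thr_ht b.
    have := thr_ht (s_ g b); rewrite ht_sref -/c.
    have : 0 < ht g -> 0 < c * ht g by nia.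
    have : thr g = 0 -> thr g * c = 0 by move=> ->; rewrite mul0r.
    have : thr g = 1 -> thr g * c = c by move=> ->; rewrite mul1r.
    lia.
  (* As a root, [b'] is [c] times [g] minus [b], and [es g b >= 1] says that [(b', k')] is positive.
     For [c = 1] this already decomposes [g]. *)
  pose b' := neg (s_ g b); pose k' := thr g * c - thr b.
  have hb' : ht b' = c * ht g - ht b by rewrite ht_neg ht_sref -/c; lia.
  have Gb' : G b' = c * G g - G b by rewrite G_neg G_sref -/c; lia.
  have Hk' : thr b' <= k' by move: e1; rewrite /k' thr_neg /es -/c; lia.
  have [c1|c2] : c = 1 \/ 2 <= c by lia.
    by apply: (nodec b b' (thr b) k'); rewrite ?hb' ?Gb' /k' ?c1 //; lia.
  (* Now [cr g b = 1] and [c] is 2 or 3. With [e] the root [g - b] and, for [c = 3], [f] the root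
     [b - 2g], the root [g] splits as [b + e], [- e + b'], [f + b'] or [- e - f], according to which
     affine roots are positive. *)
  have cb : cr b g * cr g b <= 3.
    apply: cr_bound => //; first by rewrite eq_sym.
    by apply: contra n2 => /eqP ->; rewrite negK.
  have d0 := cr_gt0_sym Hc.
  have d1 : cr g b = 1 by rewrite -/c in cb; nia.
  have c3 : c <= 3 by rewrite -/c d1 in cb; lia.
  pose e := s_ b g.
  have he : ht e = ht g - ht b by rewrite ht_sref d1; lia.
  have Ge : G e = G g - G b by rewrite G_sref d1; lia.
  have [He|He] := leP (thr e) (thr g - thr b).
    by apply: (nodec b e (thr b) (thr g - thr b)); rewrite ?he ?Ge; lia.
  have He' : 1 - thr e <= thr b - thr g by lia.
  have [c2'|c3'] : c = 2 \/ c = 3 by lia.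
    rewrite /k' c2' in Hk' hb' Gb'.
    apply: (nodec (neg e) b' _ _ _ _ _ _ Hk');
      rewrite  ?hb' ?Gb' ?ht_neg ?G_neg ?he ?Ge; [lia|lia| |by rewrite thr_neg; exact: He'].
    by lia.
  pose f := s_ g (neg e).
  have cf1 : cr (neg e) g = 1 by rewrite cr_negl cr_srefl cr_diag d1 -/c c3'.
  have hf : ht f = ht b - 2 * ht g by rewrite ht_sref cf1 ht_neg he; lia.
  have Gf : G f = G b - 2 * G g by rewrite G_sref cf1 G_neg Ge; lia.
  have [Hf|Hf] := leP (thr f) (thr b - 2 * thr g).
    by apply: (nodec f b' (thr b - 2 * thr g) k');
      rewrite ?hb' ?Gb' ?hf ?Gf /k' ?c3' //; lia.
  by apply: (nodec (neg e) (neg f) (thr b - thr g) (2 * thr g - thr b));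
    rewrite ?ht_neg ?G_neg ?thr_neg ?hf ?Gf ?he ?Ge; lia.
move=> b n1 n2; have [Hc|[Hc|Hc]] : 0 < cr b g \/ cr b g = 0 \/ cr b g < 0 by lia.
- exact: Hpos.
- rewrite /es Hc; have := thr_ht b; have := thr_ht (s_ g b).
  by rewrite ht_sref Hc; lia.
- have : es g (neg b) = 0.
    apply: Hpos; first by apply: contra n2 => /eqP <-; rewrite negK.
      by apply: contra n1 => /eqP E; rewrite -(negK b) E negK.
    by rewrite cr_negl; lia.
  by rewrite es_neg; lia.
Qed.

(* [v] is length positive for [x]. *)
Definition LP (x : Wa) (v : W) : Prop := forall b, pos b -> 0 <= ell x (v b).

Lemma LPP x v : LP x v \/ exists2 b, pos b & ell x (v b) < 0.
Proof.
have [/existsP[b /andP[Hb H]]|H] := boolP [exists b, pos b && (ell x (v b) < 0)].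
  by right; exists b.
left=> b Hb; move/existsPn/(_ b): H; rewrite Hb /=; lia.
Qed.

(** For [v] in the Weyl group, a lower bound of the affine length of [x], attained when [v] is
    length positive: see [lpsum_le] and [lpsum_LP]. *)
Definition lpsum (x : Wa) (v : W) : int := \sum_(b | pos b) ell x (v b).

Lemma lpsum_mul (x z : Wa) : inW z.1 -> lsi (x ** z) = lpsum x z.1 + lsi z.
Proof.
by move=> Hz; rewrite /lsi -big_split /=; apply: eq_bigr => b _; exact: ell_mul.
Qed.

Lemma ell_mulsa x g y b : inW y.1 ->
  ell (x ** sa g) ((lsm g y).1 b) = ell x (y.1 b) - es g (y.1 b).
Proof.
move=> Hy; rewrite ell_mul; last exact: inW_sref.
by rewrite lsm1 // WmulE ell_sa es_sref /= sref_invol.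
Qed.

(** A simple affine reflection inverted by [x] raises [y], because [y.1] is length positive. If it
    also raises [y'], the hypotheses pass to [x ** sa g] with smaller [lpsum]; otherwise it lowers
    [y']. Iteration reads a reduced word of [x] from the right. *)
Lemma up_step x y y' : inW x.1 -> inW y.1 -> inW y'.1 -> LP x y.1 ->
  (exists2 b, pos b & ell x (y'.1 b) < 0) ->
  exists g, [/\ asimple g, 0 < ell x g, pos (Winv y.1 g) &
    pos (Winv y'.1 g) ->
    [/\ LP (x ** sa g) (lsm g y).1,
        exists2 b, pos b & ell (x ** sa g) ((lsm g y').1 b) < 0
      & lpsum (x ** sa g) (lsm g y).1 = lpsum x y.1 - 1]].
Proof.
move=> Hx Hy Hy' HLP [c Hc Hlt].
have [g Hg Hgx] : exists2 g, asimple g & 0 < ell x g.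
  by apply: (@simple_exists x (neg (y'.1 c))); rewrite // ell_neg //; lia.
have Hp : pos (Winv y.1 g).
  rewrite -[pos _]negbK -posN_neg -Winv_neg //; apply/negP => Hn.
  by have := HLP _ Hn; rewrite Winv_r // ell_neg //; lia.
have esle e : (e != neg g) -> es g e = 0 \/ (e = g /\ es g e = 1).
  move=> ne; have [->|neg] := eqVneq e g; first by right; rewrite es_diag.
  by left; apply: Hg.
exists g; split=> // Hp'; split.
- move=> b Hb; rewrite ell_mulsa //.
  have nb : y.1 b != neg g.
    apply/eqP => E; have := Hp; rewrite -[g]negK -E -inW_neg // Winv_l // posN_neg Hb //.
  by case: (esle _ nb) => [->|[-> ->]]; have := HLP _ Hb; lia.
- exists c => //; rewrite ell_mulsa //.
  have nc : y'.1 c != neg g.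
    apply/eqP => E; have := Hp'; rewrite -[g]negK -E -inW_neg // Winv_l // posN_neg Hc //.
  by case: (esle _ nc) => [->|[_ ->]]; lia.
- rewrite /lpsum; under eq_bigr do rewrite ell_mulsa //.
  by rewrite sumrB sum_es // Hp.
Qed.

(** * Dominant translations *)

Definition rhov : X := \sum_(c | pos c) corX c.

(** Reflection in [s] permutes the positive roots other than [s] and negates [cr s], so their
    contributions cancel. *)
Lemma pair_rhov s : s \in simple -> pairR rhov s = 2.
Proof.
move=> Hs; have Hp := simple_pos Hs.
rewrite /rhov pairR_sum (bigD1 s) //= -/(cr s s) cr_diag.
pose S := \sum_(c | pos c && (c != s)) cr s c.
suff S0 : S = - S by rewrite -[X in 2 + X]/S; lia.
rewrite /S {1}(reindex_inj (@sref_inj s)) -sumrN.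
apply: eq_big => [c|c _]; last by rewrite cr_sref -/(neg s) cr_negl.
have sub d : pos d && (d != s) -> pos (s_ s d) && (s_ s d != s).
  move=> /andP[Hd nds]; rewrite sref_simple_pos //=.
  apply: contraTneq Hd => E; rewrite -(sref_invol s d) E -/(neg s) posN_neg Hp //.
by apply/idP/idP => [/sub|/sub //]; rewrite sref_invol.
Qed.

Lemma pair_pos la b : (forall s, s \in simple -> 0 <= pairR la s) -> pos b ->
  0 <= pairR la b.
Proof.
move=> Hla Hb; rewrite pair_cf; apply: sumr_ge0 => s Hs.
by apply: mulr_ge0; [exact: pos_cf|exact: Hla].
Qed.

Lemma pair_gt0 la b s : (forall t, t \in simple -> 0 <= pairR la t) -> pos b ->
  s \in simple -> 0 < cf b s -> 0 < pairR la s -> 0 < pairR la b.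
Proof.
move=> Hla Hb Hs Hc Hl; rewrite pair_cf (bigD1 s) //=.
apply: ltr_pwDl; first exact: mulr_gt0.
by apply: sumr_ge0 => t /andP[Ht _]; apply: mulr_ge0; [exact: pos_cf|exact: Hla].
Qed.

Lemma pos_cf_gt0 b : pos b -> exists2 s, s \in simple & 0 < cf b s.
Proof.
move=> Hb; have [/existsP[s /andP[Hs H]]|H0] := boolP [exists s, (s \in simple) && (0 < cf b s)].
  by exists s.
have := Hb; rewrite pos_ht /ht big1 // => s Hs.
by move/existsPn/(_ s): H0; have := pos_cf Hb Hs; rewrite Hs /=; lia.
Qed.

Definition tr (u : W) (la : X) : Wa := (W1 N, iact (Winv u) la).

Lemma ell_tr u la b : inW u -> ell (tr u la) b = pairR la (Winv u b).
Proof. by move=> Hu; rewrite /ell /tr /= W1E iact_pair; [lia|exact: inWV]. Qed.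

(** If the last letter of a shortest word were sent to a positive root, [exchange] would shorten the
    word. *)
Lemma simple_inversion w : inW w -> w <> W1 N -> exists2 s, s \in simple & ~~ pos (w s).
Proof.
move=> Hw nw1.
have [/existsP[s /andP[Hs H]]|H0] := boolP [exists s, (s \in simple) && ~~ pos (w s)].
  by exists s.
have wpos s : s \in simple -> pos (w s).
  by move=> Hs; move/existsPn/(_ s): H0; rewrite Hs negbK.
have [t [Ht st Et]] := word_linv Hw.
suff l0 : linv w = 0.
  by move: st; rewrite l0 => -[/size0nil t0]; rewrite t0 /= in Et; rewrite -Et in nw1.
case/lastP: t Ht st Et => [_ /esym //|t a].
rewrite /simple_word all_rcons => /andP[Ha Ht] st Et; exfalso.
have Hwa := wpos _ Ha.
have Et' : prodW t (neg a) = w a.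
  by rewrite -Et -cats1 prodW_cat /= Wmul1 WmulE.
have Hn : ~~ pos (neg a) by rewrite posN_neg simple_pos.
have [r [Hr sr Er]] := exchange Ht Hwa Hn Et'.
have : linv w <= (size r)%:Z.
  suff -> : w = prodW r by exact: linv_prodW.
  rewrite Er -Et' -WmulsE; last by exists t.
  by rewrite srefN -Et -cats1 prodW_cat /= Wmul1.
by rewrite -st size_rcons; lia.
Qed.

(** Strict dominance of [rhov] turns any simple inversion of the quotient of [u'] by [u] into a
    negative value. This translation supplies the letters in [minrep_sle]. *)
Lemma LP_tr_regular u u' : inW u -> inW u' -> u <> u' ->
  LP (tr u rhov) u /\ exists2 b, pos b & ell (tr u rhov) (u' b) < 0.
Proof.
move=> Hu Hu' nuu.
have dom s : s \in simple -> 0 <= pairR rhov s by move/pair_rhov->.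
split=> [b Hb|]; first by rewrite ell_tr // Winv_l // pair_pos.
have Hg : inW (Wmul (Winv u) u') by apply: inWM => //; exact: inWV.
have [|s Hs Hn] := simple_inversion Hg.
  move=> E; apply: nuu; apply/ffunP => j; have := congr1 (fun f : W => u (f j)) E.
  by rewrite WmulE W1E Winv_r.
exists s; first exact: simple_pos.
rewrite ell_tr // -WmulE.
have : 0 < pairR rhov (neg (Wmul (Winv u) u' s)); last by rewrite pair_neg; lia.
have Hp : pos (neg (Wmul (Winv u) u' s)) by rewrite posN_neg.
have [t Ht Hct] := pos_cf_gt0 Hp.
by apply: (pair_gt0 dom Hp Ht Hct); rewrite pair_rhov.
Qed.

(** * Saturated chains and minimal weights *)

Definition cover (y y' : Wa) : Prop := sstep y y' /\ lsi y' = lsi y + 1.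
Local Notation covp := (star cover).

Lemma covp_sle y y' : covp y y' -> sle y y'.
Proof. by elim=> [|z z' _ IH [H _]]; [exact: star_refl|exact: star_step IH H]. Qed.

Lemma cover_up g y : asimple g -> inW y.1 -> pos (Winv y.1 g) -> cover y (lsm g y).
Proof. by move=> Hg Hy Hp; split; [exact: lsm_up|rewrite lsi_lsm // Hp]. Qed.

Lemma Winv_lsm_diag g y : inW y.1 -> pos (Winv (lsm g y).1 g) = ~~ pos (Winv y.1 g).
Proof. by move=> Hy; rewrite Winv_lsm // -/(neg g) Winv_neg // posN_neg. Qed.

(** A cover from an element raised by [g] to one lowered by [g] is the reflection itself, by
    comparing [lsi]; the new chain then runs through [z]. Covers between lowered elements are
    carried to covers. *)
Lemma covp_lsm g z z' : asimple g -> inW z.1 -> covp z z' ->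
  ~~ pos (Winv z.1 g) -> ~~ pos (Winv z'.1 g) -> covp (lsm g z) (lsm g z').
Proof.
move=> Hg Hz H Hn; elim: H => [_|w z1 Hw IH [Hs El] Hn1]; first exact: star_refl.
have Hw1 : inW w.1 by apply/(inW_sle (covp_sle Hw)).
have Hz1 : inW z1.1 by apply/(inW_sstep Hs).
have [Hp|Hp] := boolP (pos (Winv w.1 g)); last first.
  apply: star_step (IH Hp) _.
  have [E|H] := left_sstep Hg Hw1 Hs.
    by move: Hn1; rewrite E Winv_lsm_diag // Hp.
  by split=> //; rewrite !lsi_lsm // (negPf Hp) (negPf Hn1) El; lia.
have [->|H] := left_sstep Hg Hw1 Hs.
  rewrite lsmK //; apply: star_trans Hw; apply: star1.
  by rewrite -{2}(lsmK g Hz); apply: cover_up; rewrite ?Winv_lsm_diag //; exact: inW_lsm.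
have := lsi_sstep (inW_lsm g Hw1) H.
by rewrite !lsi_lsm // Hp (negPf Hn1) El; lia.
Qed.

(** The minimum is required to be reached by a saturated chain so that it can be read as the weight
    of a path in the quantum Bruhat graph. *)
Definition minrep (y : Wa) (u' : W) : Prop :=
  exists eta, covp y (u', eta) /\ forall eta', sle y (u', eta') -> leX eta eta'.

Lemma LP_lpsum x v : LP x v -> 0 <= lpsum x v.
Proof. by move=> H; apply: sumr_ge0. Qed.

Lemma lsm_pair g u nu : inW u ->
  lsm g (u, nu) = (Wmul (s_ g) u, nu + corX (Winv u g) *~ thr g).
Proof. by move=> Hu; rewrite /lsm /rf /= WmulsE // Winv_r. Qed.

(** Inner induction on [lpsum], within the induction on [lsi y' - lsi y]: each letter from [up_step]
    either raises both ends or shortens the interval. *)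
Lemma minrep_ind (d : nat) :
  (forall y y', inW y.1 -> sle y y' -> lsi y' - lsi y < d%:Z -> minrep y y'.1) ->
  forall (L : nat) (x y y' : Wa), inW x.1 -> inW y.1 -> LP x y.1 ->
    (exists2 b, pos b & ell x (y'.1 b) < 0) -> lpsum x y.1 < L%:Z ->
    sle y y' -> lsi y' - lsi y < d.+1%:Z -> minrep y y'.1.
Proof.
move=> IHd; elim=> [|L IHL] x y y' Hx Hy HLP Hnb HL Hle Hd.
  by have := LP_lpsum HLP; lia.
have Hy' : inW y'.1 by apply/(inW_sle Hle).
have [g [Hg Hgx Hp Hp']] := up_step Hx Hy Hy' HLP Hnb.
have Hsy := inW_lsm g Hy; have Hup := lsm_up Hy Hp.
(* If [g] lowers [y'], lifting lets the interval start at [lsm g y], and the outer hypothesis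
   applies. *)
have [Hn|Hn] := boolP (pos (Winv y'.1 g)); last first.
  have Hsle eta : sle y (y'.1, eta) -> sle (lsm g y) (y'.1, eta).
    move=> H; have [//|H'] := lift1 Hg Hy H.
    by apply: star_step H' _; exact: lsm_down.
  have [||eta [Hc Hm]] := IHd (lsm g y) y' Hsy.
  - by have := Hsle y'.2; rewrite -surjective_pairing; apply.
  - by rewrite lsi_lsm // Hp; lia.
  exists eta; split; last by move=> eta' /Hsle; exact: Hm.
  by apply: star_trans Hc; apply: star1; exact: cover_up.
have [H1 H2 H3] := Hp' Hn.
have Hsle eta : sle y (y'.1, eta) -> sle (lsm g y) (lsm g (y'.1, eta)).
  move=> H; have [H'|//] := lift1 Hg Hy H.
  by apply: star_step H' _; exact: lsm_up.
have [||||eta [Hc Hm]] := IHL (x ** sa g) (lsm g y) (lsm g y') _ Hsy H1 H2.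
- by apply: inW_mul => //; exact: inW_sref.
- by rewrite H3; lia.
- by have := Hsle y'.2; rewrite -surjective_pairing; apply.
- by rewrite !lsi_lsm // Hp Hn; lia.
(* [lsm g] shifts all elements with finite part [y'.1] by the same [t], so minimality transfers
   back. *)
pose t := corX (Winv y'.1 g) *~ thr g.
have E : ((lsm g y').1, eta) = lsm g (y'.1, eta - t).
  by rewrite lsm1 // lsm_pair // subrK.
exists (eta - t); split.
  rewrite -[y](lsmK g) // -[(y'.1, _)](lsmK g) //; apply: covp_lsm => //.
  - by rewrite -E.
  - by rewrite Winv_lsm_diag // Hp.
  - by rewrite Winv_lsm_diag //= Hn.
move=> eta' /Hsle; rewrite lsm_pair // -lsm1 // => /Hm.
by apply: leX_shift; rewrite opprB addrA addrAC.
Qed.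

Lemma minrep_sle y y' : inW y.1 -> sle y y' -> minrep y y'.1.
Proof.
have H (d : nat) : forall y y', inW y.1 -> sle y y' -> lsi y' - lsi y < d%:Z -> minrep y y'.1.
  elim: d => [|d IHd] z z' Hz Hle Hd; first by have := lsi_sle_le Hz Hle; lia.
  have [E|/eqP nE] := eqVneq z.1 z'.1.
    exists z.2; split; first by rewrite -E -surjective_pairing; exact: star_refl.
    by move=> eta' /sle_leX.
  have Hz' : inW z'.1 by apply/(inW_sle Hle).
  have [H1 H2] := LP_tr_regular Hz Hz' nE.
  apply: (minrep_ind IHd (L := `|lpsum (tr z.1 rhov) z.1|.+1) _ Hz H1 H2 _ Hle Hd).
    exact: inW1.
  by have := LP_lpsum H1; lia.
move=> Hy Hle; apply: (H `|lsi y' - lsi y|.+1 y y' Hy Hle).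
by have := lsi_sle_le Hy Hle; lia.
Qed.

(** A step with [m = 1] is allowed in every positive direction, as [thr] is at most 1. *)
Lemma sle_conn u u' nu : inW u -> inW u' -> exists eta, sle (u, nu) (u', eta).
Proof.
move=> Hu Hu'; have [s [Hs Es]] : inW (Wmul (Winv u) u') by apply: inWM => //; exact: inWV.
have -> : u' = Wmul u (prodW s).
  by rewrite Es; apply/ffunP => j; rewrite !WmulE Winv_r.
elim: s u nu Hs Hu {Hu' Es} => [|a s IH] u nu /= Hs Hu.
  by rewrite Wmul1; exists nu; exact: star_refl.
case/andP: Hs => Ha Hs; rewrite WmulA.
have [|eta H] := IH (Wmul u (s_ a)) (nu + corX a *~ 1) Hs.
  by apply: inWM => //; exact: inW_sref.
exists eta; apply: star_trans H; apply: star1; exists a, 1; split=> //.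
  exact: simple_pos.
by have := thr_ht (u a); rewrite /=; lia.
Qed.

(** * The quantum Bruhat graph *)

Local Notation qb_edge := (qb_edge root coroot simple).
Local Notation quantum := (quantum_edge root coroot simple).
Local Notation qb_path := (qb_path root coroot simple).
Local Notation qb_wt := (qb_wt root coroot simple corX).

Definition rr (nu : X) : int := \sum_(b | pos b) pairR nu b.

Lemma rrD x y : rr (x + y) = rr x + rr y.
Proof. by rewrite /rr -big_split; apply: eq_bigr => b _; rewrite pairRD. Qed.

Lemma rrMz x k : rr (x *~ k) = k * rr x.
Proof. by rewrite /rr mulr_sumr; apply: eq_bigr => b _; rewrite pairRMz. Qed.

Lemma rr0 : rr 0 = 0.
Proof. by rewrite /rr big1 // => b _; rewrite pairR0. Qed.

Lemma lsiE y : lsi y = linv y.1 + rr y.2.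
Proof.
rewrite /lsi /linv /rr -big_split /=; apply: eq_bigr => b Hb.
by rewrite /ell (thr_pos Hb); lia.
Qed.

(** Translation by the coroot is a composite of two steps, each raising [lsi] by at least one. *)
Lemma rr_cor a : pos a -> 2 <= rr (corX a).
Proof.
move=> Ha; pose y : Wa := (W1 N, 0).
have := @lsi_rf y a 0 inW1 Ha; rewrite W1E thr_pos // => /(_ isT) H1.
have := @lsi_rf (rf y a 0) a 1 (@inW_rf y a 0 inW1) Ha.
rewrite /= WmulE W1E -/(neg a) thr_neg thr_pos // => /(_ isT).
have -> : rf (rf y a 0) a 1 = (W1 N, corX a).
  by rewrite /rf /= Wmul_sref2 mulr0z !add0r.
by move: H1; rewrite (lsiE (_, corX a)) (lsiE y) /= rr0; lia.
Qed.

Lemma rho2E a : rho2 root coroot simple a = (rr (corX a))%:~R.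
Proof. by rewrite /rr rmorph_sum; apply: eq_bigr => b _; rewrite -crE. Qed.

Lemma coxlenR w : inW w -> (coxlen w)%:R = (linv w)%:~R :> rat.
Proof. by move=> Hw; rewrite -(coxlenE Hw) pmulrn. Qed.

Lemma bruhat_edgeE u a : inW u -> bruhat_edge root coroot simple u a =
  pos a && (linv (Wmul u (s_ a)) == linv u + 1).
Proof.
move=> Hu; have Hus := inWM Hu (inW_sref a).
by rewrite /bruhat_edge -(coxlenE Hu) -(coxlenE Hus); congr (_ && _); lia.
Qed.

Lemma quantumE u a : inW u -> quantum u a =
  pos a && (linv (Wmul u (s_ a)) == linv u + 1 - rr (corX a)).
Proof.
move=> Hu; have Hus := inWM Hu (inW_sref a).
rewrite /quantum_edge !coxlenR // rho2E.
by rewrite -[1]/(1%:~R) -intrD -intrB eqr_int.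
Qed.

Lemma cover_qb y y' : inW y.1 -> cover y y' -> exists a, qb_edge y.1 a /\
  y' = (Wmul y.1 (s_ a), y.2 + if quantum y.1 a then corX a else 0).
Proof.
move=> Hy [[a [m [Ha Hm Ey]]] El]; exists a.
have r2 := rr_cor Ha.
have lrf k : lsi (rf y a k) = linv (Wmul y.1 (s_ a)) + rr y.2 + k * rr (corX a).
  by rewrite lsiE /= rrD rrMz addrA.
(* A step with [m - 1] would also raise [lsi], yet its value is smaller by [rr (corX a)], which is
   at least 2, while [m] raises it by only 1. *)
have Em : m = thr (y.1 a).
  apply/eqP; rewrite eq_le Hm andbT leNgt; apply/negP => Hlt.
  have : thr (y.1 a) <= m - 1 by lia.
  move=> /(lsi_rf Hy Ha); move: El; rewrite Ey !lrf; nia.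
move: El; rewrite Ey lrf lsiE => El.
rewrite /qb_edge bruhat_edgeE // quantumE // Ha /= /rf.
have := thr_ht (y.1 a); rewrite -Em => -[[m0 _]|[m1 _]].
  rewrite m0 mulr0z; rewrite m0 in El.
  by case: (linv _ =P linv y.1 + 1 - _) => H; split=> //; try lia; apply/orP; left; lia.
rewrite m1 mulr1z; rewrite m1 in El.
by case: (linv _ =P linv y.1 + 1 - _) => H; rewrite ?orbT; split=> //; exfalso; lia.
Qed.

Lemma qb_cover u nu a : inW u -> qb_edge u a ->
  cover (u, nu) (Wmul u (s_ a), nu + if quantum u a then corX a else 0).
Proof.
move=> Hu; rewrite /qb_edge bruhat_edgeE //.
have Hus := inWM Hu (inW_sref a).
case: (boolP (quantum u a)) => [Hq _|_].
  move: Hq; rewrite quantumE // => /andP[Ha /eqP E].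
  split; last by rewrite !lsiE /= rrD E; lia.
  exists a, 1; split=> //=; first by have := thr_ht (u a); lia.
rewrite orbF => /andP[Ha /eqP E].
split; last by rewrite !lsiE /= addr0 E; lia.
exists a, 0; split=> //.
(* Along a Bruhat edge [u a] is positive: otherwise the opposite step with [m = 0] would raise the
   length as well. *)
have [//|[H1 _]] := thr_ht (u a) => [[->]//|].
have := @lsi_rf (Wmul u (s_ a), nu) a 0 Hus Ha.
rewrite /= WmulE -/(neg a) inW_neg // thr_neg H1 => /(_ isT).
rewrite !lsiE /rf /= Wmul_sref2 mulr0z addr0 E; lia.
Qed.

Lemma qb_path_covp u v p nu : inW u -> qb_path u v p ->
  covp (u, nu) (v, nu + qb_wt u p) /\
  lsi (v, nu + qb_wt u p) = lsi (u, nu) + (size p)%:Z.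
Proof.
elim: p u nu => [|a p IH] u nu Hu /=.
  by move/eqP->; rewrite !addr0; split=> //; exact: star_refl.
move=> /andP[He Hp]; have Hc := qb_cover nu Hu He.
have [H1 H2] := IH _ (nu + if quantum u a then corX a else 0) (inWM Hu (inW_sref a)) Hp.
rewrite addrA H2; case: (Hc) => _ ->; split; last by lia.
by apply: star_trans H1; exact: star1.
Qed.

Lemma qb_path_rcons u v p a : qb_path u v p -> qb_edge v a ->
  qb_path u (Wmul v (s_ a)) (rcons p a) /\
  qb_wt u (rcons p a) = qb_wt u p + if quantum v a then corX a else 0.
Proof.
move=> Hp He; elim: p u Hp => [|b p IH] u /=.
  by move/eqP=> ->; rewrite He eqxx addr0 add0r.
by move=> /andP[-> /IH[-> ->]]; rewrite addrA.
Qed.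

Lemma covp_qb_path y y' : inW y.1 -> covp y y' ->
  exists p, qb_path y.1 y'.1 p /\ y'.2 = y.2 + qb_wt y.1 p.
Proof.
move=> Hy; elim=> [|z z' Hz [p [Hp Ez]] Hc].
  by exists [::]; rewrite /= eqxx addr0.
have Hz1 : inW z.1 by apply/(inW_sle (covp_sle Hz)).
have [a [He ->]] := cover_qb Hz1 Hc.
have [H1 H2] := qb_path_rcons Hp He.
by exists (rcons p a); split=> //; rewrite H2 /= Ez addrA.
Qed.

Lemma leX_rr_eq x y : leX x y -> rr y <= rr x -> x = y.
Proof.
move=> [c Hc] Hr; apply/esym/eqP; rewrite -subr_eq0 Hc; apply/eqP.
have E : rr y = rr x + \sum_(a | pos a) rr (corX a) *+ c a.
  rewrite -[y in LHS](subrK x) rrD addrC; congr (_ + _); rewrite Hc.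
  elim/big_rec2: _ => [|a u v _ IH]; first exact: rr0.
  by rewrite rrD IH pmulrn rrMz -mulr_natl natz.
have P a : pos a -> 0 <= rr (corX a) *+ c a.
  by move=> Ha; apply: mulrn_wge0; have := rr_cor Ha; lia.
have /eqP : \sum_(a | pos a) rr (corX a) *+ c a = 0.
  by apply/eqP; rewrite eq_le sumr_ge0 // andbT; lia.
rewrite psumr_eq0 // => /allP H; rewrite big1 // => a Ha.
have := H a; rewrite mem_index_enum Ha => /(_ isT); rewrite mulrn_eq0.
by have := rr_cor Ha; case: (rr _ =P 0) => [->//|_ _]; rewrite orbF => /eqP ->.
Qed.

(* A path visiting no vertex twice has at most [N ^ N] edges. *)
Lemma qb_path_short u v p : qb_path u v p ->
  exists2 q, qb_path u v q & (size q <= N ^ N)%N.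
Proof.
pose e := [rel x y : W | [exists a, qb_edge x a && (y == Wmul x (s_ a))]].
move=> Hp.
have [vs Hvs Hl] : exists2 vs, path e u vs & last u vs = v.
  elim: p u Hp => [|a p IH] u /=; first by move/eqP <-; exists [::].
  move=> /andP[He /IH[vs Hvs Hl]]; exists (Wmul u (s_ a) :: vs) => //=.
  by rewrite Hvs andbT; apply/existsP; exists a; rewrite He eqxx.
case/shortenP: Hvs Hl => vs' Hvs' Huniq _ Hl.
have Hsz : (size vs' <= N ^ N)%N.
  have := card_uniqP Huniq; have := max_card (mem (u :: vs')).
  by rewrite card_ffun !card_ord /= => H E; move: H; rewrite E; exact: ltnW.
suff [q Hq Hqs] : exists2 q, qb_path u v q & size q = size vs'.
  by exists q; rewrite ?Hqs.
elim: vs' u Hvs' Hl {Huniq Hsz Hp} => [|w vs' IH] u /=.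
  by move=> _ ->; exists [::] => //=.
move=> /andP[/existsP[a /andP[He /eqP E]] Hvs'] Hl.
have [q Hq Hqs] := IH _ Hvs' Hl.
by exists (a :: q) => /=; rewrite ?Hqs // He -E.
Qed.

(** The number of edges of a path from [u] to [v] and [rr] of its weight differ by a constant. All
    path weights lie above the minimal [eta], so the shortest paths are those of weight [eta],
    whichever one [pick] returns. *)
Lemma qwt_spec u v : inW u -> inW v ->
  sle (u, 0) (v, qwt u v) /\ forall eta, sle (u, 0) (v, eta) -> leX (qwt u v) eta.
Proof.
move=> Hu Hv; have [eta0 H0] := sle_conn 0 Hu Hv.
have [eta [Hc Hm]] := minrep_sle (y := (u, 0)) Hu H0.
have [p [Hp /= Ep]] := covp_qb_path (y := (u, 0)) Hu Hc; rewrite add0r in Ep.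
have Hpath t : qb_path u v t -> (size p <= size t)%N /\
    (size t = size p -> qb_wt u t = eta).
  move=> Ht; have [H1 H2] := qb_path_covp 0 Hu Ht.
  have [_ H3] := qb_path_covp 0 Hu Hp.
  rewrite !add0r in H1 H2 H3; have Hle := Hm _ (covp_sle H1).
  have Hrr : rr eta <= rr (qb_wt u t).
    rewrite leNgt; apply/negP => Hlt; move: (Hlt).
    by rewrite (leX_rr_eq Hle (ltW Hlt)) ltxx.
  move: H2 H3; rewrite -Ep !lsiE /= => H2 H3; split; first by lia.
  by move=> Hst; apply/esym/leX_rr_eq => //; move: H2 H3; rewrite Hst; lia.
have [q Hq Hqs] := qb_path_short Hp.
have tupP d : reflect (exists2 t, qb_path u v t & size t = d)
    [exists t : d.-tuple I, qb_path u v t].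
  apply: (iffP existsP) => [[t Ht]|[t Ht /eqP sd]].
    by exists t => //; rewrite size_tuple.
  by exists (Tuple sd).
have Ed : qdist root coroot simple u v = size p.
  apply: find_iota.
  - by apply/tupP; exists p.
  - by apply: leq_trans Hqs; have [] := Hpath _ Hq.
  - by move=> j /tupP[t Ht <-]; have [] := Hpath _ Ht.
suff -> : qwt u v = eta by split=> //; exact: covp_sle.
rewrite /Defs.qwt; case: pickP => [t Ht|H].
  by have [_] := Hpath _ Ht; apply; rewrite size_tuple.
have sp : size p == qdist root coroot simple u v by rewrite Ed.
by have := H (Tuple sp); rewrite Hp.
Qed.

Lemma sle_qwt u nu u' nu' : inW u -> inW u' ->
  sle (u, nu) (u', nu') <-> leX (qwt u u') (nu' - nu).
Proof.
move=> Hu Hu'; have [H1 H2] := qwt_spec Hu Hu'.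
rewrite (sle_shiftE _ _ _ _ (- nu)) subrr; split; first exact: H2.
by move=> H; apply: star_trans H1 _; exact: leX_sle.
Qed.

(** * Chains in a simple direction *)

(** The shortest move up in direction [a], at the least admissible level; two of them add
    [corX a]. *)
Definition sigma (a : I) (y : Wa) : Wa := rf y a (thr (y.1 a)).

Lemma sstep_sigma a y : pos a -> sstep y (sigma a y).
Proof. by move=> Ha; exists a, (thr (y.1 a)). Qed.

Lemma inW_sigma a y : inW y.1 -> inW (sigma a y).1.
Proof. exact: inW_rf. Qed.

Lemma rf_diag y a m : inW y.1 -> (rf y a m).1 a = neg (y.1 a).
Proof. by move=> Hy; rewrite /= WmulE -/(neg a) inW_neg. Qed.

Lemma ell_rf_diag y a m : inW y.1 ->
  ell (rf y a m) a = ell y a + 2 * m + 1 - 2 * thr (y.1 a).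
Proof. by move=> Hy; rewrite ell_rf cr_diag -/(neg a) inW_neg // thr_neg; lia. Qed.

Lemma ell_sigma a y : inW y.1 -> ell (sigma a y) a = ell y a + 1.
Proof. by move=> Hy; rewrite /sigma ell_rf_diag //; lia. Qed.

Lemma sigma2 a y : inW y.1 -> sigma a (sigma a y) = (y.1, y.2 + corX a).
Proof.
move=> Hy; rewrite {1}/sigma rf_diag // thr_neg /sigma /rf /= Wmul_sref2 -addrA -mulrzDr.
by rewrite [thr _ + _]addrC subrK.
Qed.

Lemma sigma_mul a x z : inW z.1 -> ell x (z.1 a) = 0 ->
  x ** sigma a z = sigma a (x ** z).
Proof.
move=> Hz; rewrite /ell => E; rewrite /sigma mul_rf_r //= WmulE; congr rf; lia.
Qed.

Lemma lsm_sa g y : inW y.1 -> lsm g y = sa g ** y.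
Proof.
move=> Hy; rewrite affmulE /lsm /rf /= WmulsE // Winv_r //; congr pair.
by have := iact_cor (Winv y.1 g) (thr g) Hy; rewrite Winv_r // => ->; rewrite addrC.
Qed.

Lemma sigma_lsm a g y : inW y.1 -> es g (y.1 a) = 0 ->
  lsm g (sigma a y) = sigma a (lsm g y).
Proof.
move=> Hy E; rewrite !lsm_sa //; last exact: inW_sigma.
by rewrite sigma_mul // ell_sa.
Qed.

(** [rhov - corX a] is dominant and, among the simple roots, vanishes only on [a]. Hence only [u]
    and [Wmul u (s_ a)] can be length positive for its translate. *)
Lemma LP_tr_wall a u u' : a \in simple -> inW u -> inW u' -> u' <> u ->
  u' <> Wmul u (s_ a) ->
  [/\ LP (tr u (rhov - corX a)) u, ell (tr u (rhov - corX a)) (u a) = 0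
    & exists2 b, pos b & ell (tr u (rhov - corX a)) (u' b) < 0].
Proof.
move=> Ha Hu Hu' n1 n2; set la := rhov - corX a.
have la_s s : s \in simple -> pairR la s = 2 - cr s a.
  by move=> Hs; rewrite pairRB pair_rhov.
have la_a : pairR la a = 0 by rewrite la_s // cr_diag.
have la_n s : s \in simple -> s != a -> 2 <= pairR la s.
  by move=> Hs nsa; rewrite la_s //; have := cr_simple_le0 Hs Ha nsa; lia.
have dom s : s \in simple -> 0 <= pairR la s.
  by have [->|nsa Hs] := eqVneq s a; [rewrite la_a|have := la_n _ Hs nsa; lia].
split=> [b Hb||]; rewrite ?ell_tr ?Winv_l ?pair_pos //.
pose g := Wmul (Winv u) u'.
have Hg : inW g by apply: inWM => //; exact: inWV.
have ug : Wmul u g = u' by apply/ffunP => j; rewrite !WmulE Winv_r.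
suff [b [Hb Hgb ngb]] : exists b, [/\ pos b, ~~ pos (g b) & g b != neg a].
  exists b => //; rewrite ell_tr // -WmulE -/g.
  have Hp : pos (neg (g b)) by rewrite posN_neg.
  have nb : neg (g b) != a by apply: contra ngb => /eqP <-; rewrite negK.
  have [t [Ht nta Hc]] := pos_cf_other Ha Hp nb.
  have := pair_gt0 dom Hp Ht Hc; rewrite pair_neg.
  by have := la_n _ Ht nta; lia.
have [|s Hs Hn] := simple_inversion Hg.
  by move=> E; apply: n1; rewrite -ug E Wmul1.
(* An inversion sent to [neg a] pairs to zero and is of no use. Then a simple inversion [s'] of
   [Wmul g (s_ s)] gives the inversion [s_ s s'] of [g]. *)
have [E|nE] := eqVneq (g s) (neg a); last by exists s; rewrite simple_pos.
have Hg' : inW (Wmul g (s_ s)) := inWM Hg (inW_sref s).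
have [|s' Hs' Hn'] := simple_inversion Hg'.
  move=> E'; apply: n2; rewrite -ug; congr Wmul.
  have gs : g = s_ s by rewrite -[g](Wmul_sref2 _ s) E' W1mul.
  by rewrite gs; congr s_; apply: (can_inj negK); rewrite -E gs.
have nss : s' != s.
  apply: contraNneq Hn' => ->; rewrite WmulE -/(neg s) inW_neg // E negK.
  exact: simple_pos.
exists (s_ s s'); split; first by apply: sref_simple_pos => //; exact: simple_pos.
  by rewrite -WmulE.
rewrite -E (inj_eq (inW_inj Hg)); apply: contraTneq (simple_pos Hs') => Es.
by rewrite -(sref_invol s s') Es -/(neg s) posN_neg simple_pos.
Qed.

(** The double induction of [minrep_ind]. As [ell x (y.1 a)] vanishes, the chosen letter is never in
    the direction of [y.1 a], so [lsm g] commutes with [sigma a] at [y] and keeps [ell y a]. *)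
Lemma sigma_sle_ind (d : nat) a : a \in simple ->
  (forall y y', inW y.1 -> sle y y' -> lsi y' - lsi y < d%:Z -> ell y a < ell y' a ->
     sle (sigma a y) y') ->
  forall (L : nat) (x y y' : Wa), inW x.1 -> inW y.1 -> LP x y.1 -> ell x (y.1 a) = 0 ->
    (exists2 b, pos b & ell x (y'.1 b) < 0) -> lpsum x y.1 < L%:Z ->
    sle y y' -> lsi y' - lsi y < d.+1%:Z -> ell y a < ell y' a -> sle (sigma a y) y'.
Proof.
move=> Ha IHd; elim=> [|L IHL] x y y' Hx Hy HLP Hxa Hnb HL Hle Hd Hlt.
  by have := LP_lpsum HLP; lia.
have Hy' : inW y'.1 by apply/(inW_sle Hle).
have [g [Hg Hgx Hp Hp']] := up_step Hx Hy Hy' HLP Hnb.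
have Hsy := inW_lsm g Hy; have Hsig := inW_sigma a Hy.
have na1 : y.1 a != g by apply: contraTneq Hgx => <-; rewrite Hxa.
have na2 : y.1 a != neg g.
  by apply: contraTneq Hgx => E; rewrite -[g]negK -E ell_neg // Hxa.
have Ees := Hg _ na1 na2.
have Hcomm := sigma_lsm Hy Ees.
have Hup : sstep (sigma a y) (lsm g (sigma a y)).
  apply: lsm_up => //.
  have -> : Winv (sigma a y).1 g = s_ a (Winv y.1 g).
    by apply: (inW_inj Hsig); rewrite Winv_r // WmulE sref_invol Winv_r.
  apply: sref_simple_pos => //; apply: contraNneq na1 => <-.
  by rewrite Winv_r.
have Eell : ell (lsm g y) a = ell y a by rewrite ell_lsm // Ees addr0.
have [Hn|Hn] := boolP (pos (Winv y'.1 g)); last first.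
  apply: star_trans (star1 Hup) _; rewrite Hcomm; apply: IHd => //.
  - have [//|H'] := lift1 Hg Hy Hle.
    by apply: star_step H' _; exact: lsm_down.
  - by rewrite lsi_lsm // Hp; lia.
  - by rewrite Eell.
have [H1 H2 H3] := Hp' Hn.
have Hle' : sle (lsm g y) (lsm g y').
  have [H'|//] := lift1 Hg Hy Hle.
  by apply: star_step H' _; exact: lsm_up.
have : sle (sigma a (lsm g y)) (lsm g y').
  apply: (IHL (x ** sa g)) => //.
  - by apply: inW_mul => //; exact: inW_sref.
  - by rewrite ell_mulsa // Hxa Ees.
  - by rewrite H3; lia.
  - by rewrite !lsi_lsm // Hp Hn; lia.
  rewrite Eell ell_lsm //.
  suff : 0 <= es g (y'.1 a) by lia.
  have [->|n1] := eqVneq (y'.1 a) g; first by rewrite es_diag.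
  have [E|n2] := eqVneq (y'.1 a) (neg g); last by rewrite Hg.
  have := Hn; rewrite -[g]negK -E -inW_neg // Winv_l // posN_neg.
  by rewrite simple_pos.
rewrite -Hcomm => /(lift2 Hg (inW_lsm g Hsig)).
rewrite (lsmK g Hsig) (lsmK g Hy') => -[H|//].
exact: star_trans (star1 Hup) H.
Qed.

(* [ell y a] is the position of [y] on the [sigma a]-chain of [y]: an element
   below [y'] may be moved up its chain as long as it is not ahead of [y']. *)
Lemma sigma_sle a y y' : a \in simple -> inW y.1 -> sle y y' ->
  ell y a < ell y' a -> sle (sigma a y) y'.
Proof.
move=> Ha.
have H (d : nat) : forall y y', inW y.1 -> sle y y' -> lsi y' - lsi y < d%:Z ->
    ell y a < ell y' a -> sle (sigma a y) y'.
  elim: d => [|d IHd] z z' Hz Hle Hd Hlt; first by have := lsi_sle_le Hz Hle; lia.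
  have Hz' : inW z'.1 by apply/(inW_sle Hle).
  have HleX := sle_leX Hle.
  (* Finite parts that agree, or differ by [s_ a], are not separated by the translation; there the
     claim compares cocharacters, and [leX_simple_cor] needs [a] simple. *)
  have [E|/eqP n1] := eqVneq z'.1 z.1.
    apply: star_trans (star1 (sstep_sigma _ (simple_pos Ha))) _.
    rewrite sigma2 // [z']surjective_pairing E; apply: leX_sle => //.
    by apply: leX_simple_cor => //; move: Hlt; rewrite /ell E; lia.
  have [E|/eqP n2] := eqVneq z'.1 (Wmul z.1 (s_ a)).
    rewrite [z']surjective_pairing E; apply: leX_sle.
      by apply: inWM => //; exact: inW_sref.
    have := Hlt; rewrite /ell E WmulE -/(neg a) inW_neg // thr_neg.
    have [[-> _] _|[-> _] Hlt'] := thr_ht (z.1 a); first by rewrite addr0.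
    by apply: leX_simple_cor => //; lia.
  have [H1 H2 H3] := LP_tr_wall Ha Hz Hz' n1 n2.
  apply: (sigma_sle_ind Ha IHd
    (L := `|lpsum (tr z.1 (rhov - corX a)) z.1|.+1) _ Hz H1 H2 H3 _ Hle Hd Hlt).
    exact: inW1.
  by have := LP_lpsum H1; lia.
move=> Hy Hle; apply: (H `|lsi y' - lsi y|.+1 y y' Hy Hle).
by have := lsi_sle_le Hy Hle; lia.
Qed.

Lemma inW_iter_sigma a k y : inW y.1 -> inW (iter k (sigma a) y).1.
Proof. by move=> Hy; elim: k => //= k IH; exact: inW_sigma. Qed.

Lemma ell_iter_sigma a k y : inW y.1 -> ell (iter k (sigma a) y) a = ell y a + k%:Z.
Proof.
move=> Hy; elim: k => [|k IH] /=; first by rewrite addr0.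
by rewrite ell_sigma ?IH; [lia|exact: inW_iter_sigma].
Qed.

Lemma iter_sigma_sle a k y y' : a \in simple -> inW y.1 -> sle y y' ->
  ell y a + k%:Z <= ell y' a -> sle (iter k (sigma a) y) y'.
Proof.
move=> Ha Hy Hle; elim: k => [//|k IH] /= Hk.
apply: sigma_sle => //; first exact: inW_iter_sigma.
  by apply: IH; lia.
by rewrite ell_iter_sigma //; lia.
Qed.

(** The coset of [y] under the group generated by the affine reflections in direction [a]. *)
Definition chn (a : I) (y y' : Wa) : Prop :=
  exists k, y' = (y.1, y.2 + corX a *~ k) \/ y' = rf y a k.

Lemma chn_refl a y : chn a y y.
Proof. by exists 0; left; rewrite mulr0z addr0 -surjective_pairing. Qed.

Lemma chn_rf a y y' m : chn a y y' -> chn a y (rf y' a m).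
Proof.
move=> [k [->|->]]; exists (k + m); [right|left]; rewrite /rf /= mulrzDr addrA //.
by rewrite Wmul_sref2.
Qed.

Lemma chn_mul_rf a x z z' m : inW z'.1 -> chn a (x ** z) (x ** z') ->
  chn a (x ** z) (x ** rf z' a m).
Proof. by move=> Hz' H; rewrite mul_rf_r //; exact: chn_rf. Qed.

Lemma chn_sle a y y' : pos a -> inW y.1 -> chn a y y' -> ell y a <= ell y' a -> sle y y'.
Proof.
move=> Ha Hy [k [->|->]].
  rewrite /ell /= pairRD pairRMz -/(cr _ _) cr_diag => H.
  rewrite {1}[y]surjective_pairing; apply: leX_sle => //.
  by apply: leX_cor => //; lia.
rewrite ell_rf_diag // => H; apply: star1; exists a, k; split=> //.
lia.
Qed.

(* For [z = (v1, 0)] the best choice is [z' = (v2, - qwt v2 v1)], which gives the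
   inequality of the theorem. *)
Definition crit (x1 x2 z : Wa) : Prop :=
  exists z', sle z' z /\ sle (x1 ** z) (x2 ** z').

(** The left side becomes [sigma a (x1 ** z)], so [sigma_sle] applies once the right side is ahead
    of [x1 ** z] in direction [a]. If it is not, [z'] moves along its own chain, below [sigma a z],
    until it is. *)
Lemma crit_sigma a x1 x2 z : a \in simple -> inW x1.1 -> inW x2.1 -> inW z.1 ->
  ell x1 (z.1 a) = 0 -> crit x1 x2 z -> crit x1 x2 (sigma a z).
Proof.
move=> Ha H1 H2 Hz E [z' [Hz'z Hle]]; rewrite /crit sigma_mul //.
have Hz' : inW z'.1 by apply/(inW_sle Hz'z).
have Hpa := simple_pos Ha.
set A := x1 ** z in Hle *; have HA : inW A.1 := inW_mul H1 Hz.
have EA : ell A a = ell z a by rewrite ell_mul // E add0r.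
have Hzs : sle z' (sigma a z) by apply: star_step Hz'z _; exact: sstep_sigma.
have HB : inW (x2 ** z').1 := inW_mul H2 Hz'.
have [HltB|HleB] := ltP (ell A a) (ell (x2 ** z') a).
  by exists z'; split=> //; exact: sigma_sle.
suff [z1 [Hz1 Hch Hell]] : exists z1, [/\ sle z1 (sigma a z), chn a (x2 ** z') (x2 ** z1)
    & ell A a < ell (x2 ** z1) a].
  exists z1; split=> //; apply: sigma_sle => //.
  apply: star_trans Hle _; apply: (chn_sle Hpa HB Hch).
  exact: le_trans HleB (ltW Hell).
have [Hlez|Hltz] := leP (ell z' a) (ell z a).
  (* Here [z'] is raised to the position of [z], or one further, where the contribution of [x2]
     changes sign. *)
  pose k := `|ell z a - ell z' a|%N.
  have Ek : ell z' a + k%:Z = ell z a by rewrite /k; lia.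
  pose w := iter k (sigma a) z'.
  have Hw : inW w.1 := inW_iter_sigma a k Hz'.
  have Ew : ell w a = ell z a by rewrite /w ell_iter_sigma.
  have Hchw : chn a (x2 ** z') (x2 ** w).
    rewrite /w; elim: (k) => [|j IH] /=; first exact: chn_refl.
    by apply: chn_mul_rf => //; exact: inW_iter_sigma.
  have Hit j : (j <= 1)%N -> sle (iter (k + j) (sigma a) z') (sigma a z).
    by move=> Hj; apply: iter_sigma_sle => //; rewrite ell_sigma //; lia.
  have [q1|q0] := ltP 0 (ell x2 (w.1 a)).
    exists w; split=> //; first by have := Hit 0%N isT; rewrite addn0.
    by rewrite ell_mul // Ew EA; lia.
  exists (sigma a w); split; first by have := Hit 1%N isT; rewrite addn1.
    exact: chn_mul_rf.
  rewrite EA (ell_mul _ _ (inW_sigma a Hw)) (ell_sigma _ Hw) Ew /sigma rf_diag //.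
  by rewrite ell_neg //; lia.
(* Here [z'] is ahead of [z], so [ell x2 (z'.1 a)] is negative; one step down the chain makes it
   positive, which outweighs the loss of 1. *)
pose w := rf z' a (thr (z'.1 a) - 1).
have Hw : inW w.1 := inW_rf _ _ Hz'.
exists w; split.
- apply: star_trans Hzs; apply: star1; exists a, (- (thr (z'.1 a) - 1)).
  by rewrite rfK rf_diag // thr_neg; split=> //; lia.
- by apply: chn_mul_rf => //; exact: chn_refl.
- move: HleB; rewrite EA (ell_mul _ _ Hz') (ell_mul _ _ Hw) /w rf_diag // ell_neg //.
  by rewrite ell_rf_diag //; lia.
Qed.

(** * The Bruhat order *)

(** Take [v] with [lpsum x v] maximal. A negative value at [v b] gives [z1] below [z] with [x ** z]
    below [x ** z1], and then [lpsum] would be larger at [z1]. *)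
Lemma LP_exists x : inW x.1 -> exists2 v, inW v & LP x v.
Proof.
move=> Hx.
pose P (v : W) : bool := `[< inW v >].
have P1 : P (W1 N) by apply/asboolP; exact: inW1.
case: (arg_maxP (lpsum x) P1) => v /asboolP Hv vmax; exists v => //.
have [//|[b Hb Hlt]] := LPP x v; exfalso.
pose z : Wa := (v, 0); pose z1 := rf z b (thr (v b) - 1).
have Hz : inW z.1 := Hv; have Hz1 : inW z1.1 := inW_rf _ _ Hz.
have /lsi_sstep -/(_ Hz1) L1 : sstep z1 z.
  exists b, (- (thr (v b) - 1)); rewrite rfK (@rf_diag z) // thr_neg.
  by split=> //=; lia.
have /lsi_sstep -/(_ (inW_mul Hx Hz)) L2 : sstep (x ** z) (x ** z1).
  exists b, (thr (v b) - 1 - pairR x.2 (v b)); rewrite mul_rf_r //; split=> //.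
  by move: Hlt; rewrite /ell affmulE /= WmulE; lia.
have Hmax : lpsum x z1.1 <= lpsum x z.1 by apply: vmax; apply/asboolP.
by move: L2; rewrite (lpsum_mul x Hz) (lpsum_mul x Hz1); lia.
Qed.

Lemma count_interval (l h : int) (m : nat) : 0 <= l -> h <= m%:Z ->
  (count (fun k : int => (l <= k) && (k < h)) [seq i%:Z | i <- iota 0 m])%:Z =
  Num.max 0 (h - l).
Proof.
move=> Hl Hh; rewrite count_map.
have H (k : nat) : (count (fun i : nat => (l <= i%:Z) && (i%:Z < h)) (iota 0 k))%:Z =
    Num.max 0 (Num.min h k%:Z - l).
  elim: k => [|k IH]; first by rewrite /=; lia.
  rewrite -addn1 iotaD count_cat add0n /= addn0 PoszD IH.
  by case: (boolP (l <= k%:Z)) => ?; case: (boolP (k%:Z < h)) => ? /=; lia.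
have := H m; rewrite (_ : Num.min h m%:Z = h) => [<- //|]; lia.
Qed.

Lemma afflenE x : (afflen x)%:Z = \sum_a Num.max 0 (ell x a).
Proof.
rewrite /Defs.afflen -[Posz _]/((_ : nat)%:Z) -natz natr_sum; apply: eq_bigr => a _.
rewrite natz; set l := thr a; set p := pairR x.2 a; set h := thr (x.1 a).
rewrite (eq_count (a2 := fun k : int => (l <= k) && (k < p + h))); last first.
  by move=> k /=; congr (_ && _); lia.
rewrite count_interval; last by have := thr_ht (x.1 a); rewrite -/h; lia.
  by rewrite /ell.
by have := thr_ht a; rewrite -/l; lia.
Qed.

Lemma afflen_reindex x v : inW v -> (afflen x)%:Z = \sum_a Num.max 0 (ell x (v a)).
Proof. by move=> Hv; rewrite afflenE (reindex_inj (inW_inj Hv)). Qed.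

Lemma lpsum_le x v : inW v -> lpsum x v <= (afflen x)%:Z.
Proof.
move=> Hv; rewrite (afflen_reindex _ Hv) (bigID pos) /=.
apply: ler_wpDr; first by apply: sumr_ge0 => a _; rewrite le_max lexx.
by apply: ler_sum => a _; rewrite le_max lexx orbT.
Qed.

Lemma lpsum_LP x v : inW x.1 -> inW v -> LP x v -> lpsum x v = (afflen x)%:Z.
Proof.
move=> Hx Hv HLP; rewrite (afflen_reindex _ Hv) (bigID pos) /=.
rewrite [X in _ = _ + X]big1 ?addr0 => [|a Ha].
  by apply: eq_bigr => a Ha; have := HLP _ Ha; lia.
have : pos (neg a) by rewrite posN_neg.
by move=> /HLP; rewrite inW_neg // ell_neg //; lia.
Qed.

(** Moved past [z], the reflection has direction [e]. For positive [e] it is a step up from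
    [x ** z]; for negative [e] the same reflection lowers [z] and cancels in the product. *)
Lemma bstep_mul x x' z : inW x.1 -> inW z.1 -> bstep x x' ->
  sstep (x ** z) (x' ** z) \/ exists z1, sstep z1 z /\ x' ** z1 = x ** z.
Proof.
move=> Hx Hz [a [m [Ha Hm ->]]]; set e := Winv z.1 a.
have ze : z.1 e = a by rewrite Winv_r.
have E : rf x a m ** z = rf (x ** z) e m by rewrite -{1}ze mul_rf_l.
have [He|He] := boolP (pos e).
  by left; rewrite E; exists e, m; split=> //=; rewrite WmulE ze.
right; pose k := m + pairR x.2 a; exists (rf z e k); split.
  exists (neg e), k; rewrite posN_neg; split=> //.
    by rewrite inW_neg ?rf_diag // ?negK ?ze //; exact: inW_rf.
  by rewrite rf_neg rfK.
rewrite mul_rf_r // E ze /= pairRD pairRMz -/(cr _ _) cr_diag.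
have -> : k - (pairR x.2 a + m * 2) = - m by rewrite /k; lia.
exact: rfK.
Qed.

(** At a length positive [v] the length of [x] is [lpsum x v]; [bstep_mul] and [lsi] then produce a
    larger [lpsum] for [x'], and [lpsum_le] concludes. *)
Lemma afflen_bstep x x' : inW x.1 -> bstep x x' -> (afflen x < afflen x')%N.
Proof.
move=> Hx Hb; have [v Hv HLP] := LP_exists Hx.
pose z : Wa := (v, 0); have Hz : inW z.1 := Hv.
rewrite -ltz_nat -(lpsum_LP Hx Hv HLP).
have Exz : lsi (x ** z) = lpsum x v + lsi z := lpsum_mul x Hz.
have [Hs|[z1 [Hs E]]] := bstep_mul Hx Hz Hb.
  have := lsi_sstep (inW_mul Hx Hz) Hs; rewrite Exz (lpsum_mul x' Hz).
  by have := lpsum_le x' Hv; rewrite /=; lia.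
have Hz1 : inW z1.1 by apply/(inW_sstep Hs).
have := lsi_sstep Hz1 Hs; move: Exz; rewrite -E (lpsum_mul x' Hz1).
by have := lpsum_le x' Hz1; lia.
Qed.

(** If exactly one positivity condition holds, the step goes backwards and the length drops; if
    neither holds, pass to the opposite affine root. *)
Lemma afflen_rf_bstep x a m : inW x.1 -> (afflen x < afflen (rf x a m))%N ->
  bstep x (rf x a m).
Proof.
move=> Hx Hlt.
have [H1|H1] := leP (thr (x.1 a)) m; have [H2|H2] := leP (thr a) (m + pairR x.2 a).
- by exists a, m.
- suff /(afflen_bstep (inW_rf a m Hx)) : bstep (rf x a m) x by lia.
  exists (neg a), m; rewrite rf_neg rfK; split=> //.
    by rewrite thr_neg pair_neg /= pairRD pairRMz -/(cr _ _) cr_diag; lia.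
  by rewrite inW_neg ?rf_diag ?negK //; exact: inW_rf.
- suff /(afflen_bstep (inW_rf a m Hx)) : bstep (rf x a m) x by lia.
  exists a, (- m); rewrite rfK; split=> //.
    by rewrite /= pairRD pairRMz -/(cr _ _) cr_diag; lia.
  by rewrite rf_diag // thr_neg; lia.
- exists (neg a), (- m); rewrite rf_neg opprK; split=> //.
    by rewrite thr_neg pair_neg; lia.
  by rewrite inW_neg // thr_neg; lia.
Qed.

Lemma inW_bstep x x' : bstep x x' -> inW x.1 -> inW x'.1.
Proof. by move=> [a [m [_ _ ->]]]; exact: inW_rf. Qed.

Lemma inW_bstar x x' : star bstep x x' -> inW x.1 -> inW x'.1.
Proof. by elim=> // z z' _ IH /inW_bstep H /IH. Qed.

Lemma bruhatP x y : inW x.1 -> bruhat x y <-> star bstep x y.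
Proof.
move=> Hx; split.
  move=> H; move: Hx; elim: H => [z Hz|z z' a k _ IH Hlt Hz]; first exact: star_refl.
  apply: star_step (IH Hz) _.
  move: Hlt; rewrite mul_affrefl; apply: afflen_rf_bstep.
  exact: inW_bstar (IH Hz) Hz.
elim=> [|z z' Hz IH Hb]; first exact: bruhat_refl.
have /afflen_bstep -/(_ _ Hb) Hlt := inW_bstar Hz Hx.
case: Hb Hlt => a [m [_ _ ->]].
have -> : rf z a m = z ** affrefl root coroot corX a (m + pairR z.2 a).
  by rewrite mul_affrefl addrK.
exact: bruhat_step.
Qed.

(** * Lifting in the Bruhat order and the two directions of the criterion *)

Lemma blift g x y : asimple g -> inW x.1 -> star bstep x y ->
  star bstep (lsm g x) y \/ star bstep (lsm g x) (lsm g y).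
Proof.
move=> Hg Hx; elim=> [|z z' Hz IH Hs]; first by right; exact: star_refl.
have Hz1 := inW_bstar Hz Hx.
case: IH => IH; first by left; exact: star_step IH Hs.
by have [->|H] := left_bstep Hg Hz1 Hs; [left|right; exact: star_step IH H].
Qed.

Lemma lsm_bstep_up g x : inW x.1 -> 0 <= ell x (Winv x.1 g) -> bstep x (lsm g x).
Proof.
move=> Hx; rewrite /ell Winv_r // => H; exists (Winv x.1 g), (thr g).
by rewrite Winv_r //; split=> //; lia.
Qed.

Lemma lsm_bstep_down g x : inW x.1 -> ell x (Winv x.1 g) < 0 -> bstep (lsm g x) x.
Proof.
move=> Hx H; have Hs := inW_lsm g Hx.
rewrite -{2}(lsmK g Hx); apply: lsm_bstep_up => //.
rewrite Winv_lsm // -/(neg g) Winv_neg // ell_neg // ell_lsm // Winv_r // es_diag; lia.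
Qed.

(** [simple_exists] applied to the inverse [xi] of [x]. *)
Lemma left_descent x b : inW x.1 -> ell x b < 0 ->
  exists2 g, asimple g & ell x (Winv x.1 g) < 0.
Proof.
move=> Hx Hb; pose xi : Wa := (Winv x.1, - iact (Winv x.1) x.2).
have Hxi : inW xi.1 := inWV Hx.
have E e : ell xi e = - ell x (Winv x.1 e).
  by rewrite /ell /xi /= pairRN iact_pair // Winv_r //; lia.
have [|g Hg Hlt] := @simple_exists xi (x.1 b) Hxi.
  by rewrite E Winv_l //; lia.
by exists g => //; move: Hlt; rewrite E; lia.
Qed.

(** Induction on the length of the quotient of [v] by [v']. At a simple inversion [a] of it,
    positivity for both [v] and [v'] forces [ell x1 (v a) = 0], so [crit_sigma] crosses this wall.
    It changes the cocharacter, hence the existential [la']. *)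
Lemma crit_gallery x1 x2 v v' la : inW x1.1 -> inW x2.1 -> inW v -> inW v' ->
  LP x1 v -> LP x1 v' -> crit x1 x2 (v, la) -> exists la', crit x1 x2 (v', la').
Proof.
move=> H1 H2 Hv Hv' HLP HLP'.
have [k] := ubnP `|linv (Wmul (Winv v') v)|%N.
elim: k v la Hv HLP => // k IH v la Hv HLP Hk Hc.
have Hg : inW (Wmul (Winv v') v) by apply: inWM => //; exact: inWV.
have [E|/eqP nE] := eqVneq (Wmul (Winv v') v) (W1 N).
  exists la; suff <- : v = v' by [].
  by apply/ffunP => j; rewrite -[v j](Winv_r _ Hv') -(WmulE (Winv v') v) E W1E.
have [a Ha Hn] := simple_inversion Hg nE.
have Ea : ell x1 (v a) = 0.
  have := HLP _ (simple_pos Ha).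
  have : pos (neg (Wmul (Winv v') v a)) by rewrite posN_neg.
  by move=> /HLP'; rewrite inW_neg // WmulE Winv_r // ell_neg //; lia.
have Hc' := @crit_sigma a x1 x2 (v, la) Ha H1 H2 Hv Ea Hc.
apply: (IH _ _ (inWM Hv (inW_sref a)) _ _ Hc').
  move=> b Hb; rewrite WmulE.
  have [->|nba] := eqVneq b a; first by rewrite -/(neg a) inW_neg // ell_neg // Ea.
  by apply: HLP; apply: sref_simple_pos.
(* With zero cocharacter and level zero, [lsi_rf] says that removing the inversion [a] shortens the
   quotient. *)
have := @lsi_rf (Wmul (Wmul (Winv v') v) (s_ a), 0) a 0.
rewrite [Wmul (Wmul (Winv v') v) _]lock /= -lock.
have Hgs := inWM Hg (inW_sref a).
move=> /(_ Hgs (simple_pos Ha)).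
rewrite WmulE -/(neg a) inW_neg // thr_pos ?posN_neg // => /(_ isT).
rewrite !lsiE /rf /= Wmul_sref2 mulr0z addr0 -WmulA.
by have := linv_ge0 (Wmul (Winv v') (Wmul v (s_ a))); lia.
Qed.

Lemma crit_bstar (x1 x2 z : Wa) : inW x1.1 -> inW x2.1 -> inW z.1 ->
  LP x1 z.1 -> crit x1 x2 z -> star bstep x1 x2.
Proof.
move=> + H2; have [k] := ubnP (afflen x2).
elim: k x1 x2 z H2 => // k IH x1 x2 z H2 Hk H1 Hz HLP Hc.
(* When every [ell x2 b] is zero, multiplication by [x2] preserves [lsi], and all the inequalities
   collapse to equalities. *)
have [/existsP[b /eqP nb]|/existsPn H0] := boolP [exists b, ell x2 b != 0]; last first.
  have {}H0 b : ell x2 b = 0 by have := H0 b; rewrite negbK => /eqP.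
  case: Hc => z' [Hz'z Hle]; have Hz' : inW z'.1 by apply/(inW_sle Hz'z).
  have L1 : lsi (x2 ** z') = lsi z'.
    by rewrite (lpsum_mul x2 Hz') /lpsum big1 ?add0r.
  have L2 := lpsum_mul x1 Hz; have L3 := LP_lpsum HLP.
  have [Ez|Hlt] := lsi_sle Hz' Hz'z; last first.
    by have := lsi_sle_le (inW_mul H1 Hz) Hle; lia.
  rewrite Ez in L1 Hle.
  have [E|Hlt] := lsi_sle (inW_mul H1 Hz) Hle; last by lia.
  by rewrite (mul_cancel Hz E); exact: star_refl.
have [b' Hb'] : exists b', ell x2 b' < 0.
  have [?|?] : ell x2 b < 0 \/ 0 < ell x2 b by lia.
    by exists b.
  by exists (neg b); rewrite ell_neg //; lia.
have [g Hg Hgx2] := left_descent H2 Hb'.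
pose x2' := lsm g x2; have H2' : inW x2'.1 := inW_lsm g H2.
have Hb2 : bstep x2' x2 := lsm_bstep_down H2 Hgx2.
have {}IH y w : inW y.1 -> inW w.1 -> LP y w.1 -> crit y x2' w -> star bstep y x2'.
  by apply: IH => //; have := afflen_bstep H2' Hb2; lia.
have x2E : x2 = lsm g x2' by rewrite lsmK.
pose d := Winv x1.1 g; have x1d : x1.1 d = g by rewrite Winv_r.
have Hinv w : inW w.1 -> Winv (x1 ** w).1 g = Winv w.1 d.
  move=> Hw; have Hxw : inW (x1 ** w).1 := inW_mul H1 Hw.
  by apply: (inW_inj Hxw); rewrite Winv_r // WmulE Winv_r.
have esP e : es g (x1.1 e) = if e == d then 1 else if e == neg d then -1 else 0.
  have [->|n1] := eqVneq e d; first by rewrite x1d es_diag.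
  have [->|n2] := eqVneq e (neg d); first by rewrite inW_neg // x1d es_neg es_diag.
  have inj := inj_eq (inW_inj H1).
  by apply: Hg; rewrite -x1d; [rewrite inj|rewrite -(inW_neg _ H1) inj].
have lift w w' : inW w.1 -> inW w'.1 -> sle (x1 ** w) (x2 ** w') ->
    sle (x1 ** w) (x2' ** w') \/ sle (lsm g x1 ** w) (x2' ** w').
  move=> Hw Hw' /(lift2 Hg (inW_mul H1 Hw)).
  by rewrite -/x2' !lsm_mul.
(* If [lsm g x1] is below [x1], then [z] stays length positive for it, both sides are lowered, and
   [blift] restores them. *)
have [Hd|Hd] := ltP (ell x1 d) 0.
  have H1' := inW_lsm g H1.
  have E1 : lsm g (lsm g x1) = x1 := lsmK g H1.
  have HLP1 : LP (lsm g x1) z.1.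
    move=> c Hcp; rewrite ell_lsm // esP; have := HLP _ Hcp.
    have [->|_] := eqVneq (z.1 c) d; first by lia.
    have [->|_] := eqVneq (z.1 c) (neg d); last by lia.
    by rewrite ell_neg //; lia.
  have Hdown : sstep (lsm g x1 ** z) (x1 ** z).
    rewrite -lsm_mul //; apply: lsm_down; first exact: inW_mul.
    rewrite Hinv //; apply/negP => Hp.
    by have := HLP _ Hp; rewrite Winv_r //; lia.
  have Hc' : crit (lsm g x1) x2' z.
    case: Hc => z' [Hz'z Hle]; exists z'; split=> //.
    have Hz' : inW z'.1 by apply/(inW_sle Hz'z).
    have [H|//] := lift _ _ Hz Hz' Hle.
    exact: star_trans (star1 Hdown) H.
  have := blift Hg H1' (IH _ _ H1' Hz HLP1 Hc'); rewrite E1 -x2E => -[H|//].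
  exact: star_step H Hb2.
have H1' := inW_lsm g H1.
(* A [v] that is length positive for the larger [lsm g x1] is so for [x1] too, and makes [lsm g]
   raise [x1 ** w]; only the right side is then lowered. *)
have [v Hv HLPs] := LP_exists H1'.
have Hpd : pos (Winv v d).
  rewrite -[pos _]negbK -posN_neg -Winv_neg //; apply/negP => Hp.
  have := HLPs _ Hp; rewrite Winv_r // ell_lsm // esP eqxx ell_neg //.
  by rewrite (negPf (neg_neq d)); lia.
have HLPv : LP x1 v.
  move=> c Hcp; have := HLPs _ Hcp; rewrite ell_lsm // esP.
  have [->|_] := eqVneq (v c) d; first by lia.
  have [E|_] := eqVneq (v c) (neg d); last by lia.
  by have := Hpd; rewrite -[d]negK -E -inW_neg // Winv_l // posN_neg Hcp.
have [la [z' [Hz'z Hle]]] : exists la, crit x1 x2 (v, la).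
  by apply: (@crit_gallery x1 x2 z.1 v z.2) => //; rewrite -surjective_pairing.
pose w : Wa := (v, la); have Hw : inW w.1 := Hv.
have Hz' : inW z'.1 by apply/(inW_sle Hz'z).
suff Hc' : crit x1 x2' w by apply: star_step (IH _ _ H1 Hw HLPv Hc') Hb2.
exists z'; split=> //; have [//|H] := lift _ _ Hw Hz' Hle.
apply: star_trans H; apply: star1; rewrite -lsm_mul //; apply: lsm_up.
  exact: inW_mul.
by rewrite Hinv.
Qed.

Lemma bstar_crit x1 x2 z : inW x1.1 -> inW z.1 -> star bstep x1 x2 -> crit x1 x2 z.
Proof.
move=> H1 Hz; elim=> [|x x' Hx [z' [Hz'z Hle]] Hb].
  by exists z; split; exact: star_refl.
have Hz' : inW z'.1 by apply/(inW_sle Hz'z).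
have [H|[w [Hw E]]] := bstep_mul (inW_bstar Hx H1) Hz' Hb.
  by exists z'; split=> //; exact: star_step Hle H.
by exists w; rewrite E; split=> //; exact: star_trans (star1 Hw) Hz'z.
Qed.

(** By [sle_qwt] the two relations become inequalities in which the free cocharacter of [z'] has
    opposite signs; adding them eliminates it. *)
Lemma critP w1 mu1 w2 mu2 v1 : inW w1 -> inW w2 -> inW v1 ->
  crit (w1, mu1) (w2, mu2) (v1, 0) <->
  exists v2, inW v2 /\
    leX (actW (Winv v1) mu1 + qwt v2 v1 + qwt (Wmul w1 v1) (Wmul w2 v2))
        (actW (Winv v2) mu2).
Proof.
move=> Hw1 Hw2 Hv1; rewrite -!/(iact _ _); have H1 := inWM Hw1 Hv1; split.
  move=> [[v2 la] [Hz Hle]]; have Hv2 : inW v2 by apply/(inW_sle Hz).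
  exists v2; split=> //; move: Hz Hle; rewrite !affmulE /= addr0.
  rewrite !sle_qwt //; last exact: inWM.
  rewrite sub0r => Ha Hb; have := leXD Ha Hb; apply: leX_shift.
  rewrite -/(iact _ _); move: (iact v1 mu1) (iact v2 mu2) (qwt _ _) (qwt _ _) => p q r s.
  have -> : - la + (q + la - p) = q - p by rewrite addrC addrAC addrK.
  by rewrite !opprD !addrA.
move=> [v2 [Hv2 Hle]]; exists (v2, - qwt v2 v1); rewrite !affmulE /= addr0.
rewrite !sle_qwt //; last exact: inWM.
rewrite sub0r opprK; split; first exact: leX_refl.
apply: leX_shift Hle; rewrite -!/(iact _ _).
move: (iact v1 mu1) (iact v2 mu2) (qwt _ _) (qwt _ _) => p q r s.
by rewrite !opprD !addrA; congr (_ - _); rewrite addrAC.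
Qed.

End AffineBruhat.

Unset Implicit Arguments.

Theorem theorem1p1 (n N : nat) (root coroot : 'I_N -> 'rV[rat]_n)
    (simple : {set 'I_N})
    (HPhi : root_system root coroot) (HDelta : root_basis root simple)
    (X : zmodType) (pairR : X -> 'I_N -> int) (corX : 'I_N -> X)
    (HX : cochar_data root coroot pairR corX)
    (w1 w2 : Wt N) (mu1 mu2 : X)
    (Hw1 : inW root coroot simple w1) (Hw2 : inW root coroot simple w2) :
  bruhat_le root coroot simple pairR corX (w1, mu1) (w2, mu2) <->
  (forall v1 : Wt N, inW root coroot simple v1 ->
     exists v2 : Wt N, inW root coroot simple v2 /\
       leX root simple corX
         (actW root coroot simple pairR corX (Winv v1) mu1
          + qwt root coroot simple corX v2 v1
          + qwt root coroot simple corX (Wmul w1 v1) (Wmul w2 v2))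
         (actW root coroot simple pairR corX (Winv v2) mu2)).
Proof.
rewrite (bruhatP HPhi HDelta HX) //; split.
  move=> H v1 Hv1; apply/(critP HPhi HDelta HX) => //.
  exact: (bstar_crit HPhi HDelta HX).
(* The converse uses the inequality at a single [v], length positive for the first element. *)
move=> H; have [v Hv HLP] := LP_exists HPhi HDelta HX (x := (w1, mu1)) Hw1.
have /(critP HPhi HDelta HX mu1 mu2 Hw1 Hw2 Hv) Hc := H v Hv.
exact: (crit_bstar HPhi HDelta HX (z := (v, 0))).
Qed.
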